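(* Suppose that $f$ is continuously differentiable on an open set containing $\operatorname{dom}\varphi$, that $\varphi$ is proper, lower semicontinuous and prox-bounded, and that $\inf F>-\infty$. Let the algorithm described in the context be run, and suppose there exists $M_B>0$ with $\|B_k\|\le M_B$ for all $k\in\mathbb{N}_0$. Suppose further that $\nabla f$ is locally Lipschitz continuous on an open set containing $\operatorname{dom}\varphi$, i.e., for all $x\in\operatorname{dom}\varphi$ there exist $L,\varepsilon>0$ such that $\|\nabla f(y)-\nabla f(z)\|\le L\|y-z\|$ for all $y,z\in\mathbb{B}_\varepsilon(x)$. Suppose that there exists a stationary point $x^*$ of $F$ which is an accumulation point of the subsequence $\{x^k\}_{k\in\mathcal S}$ of successful iterates, and that $F$ has the Kurdyka--\L{}ojasiewicz property at $x^*$ with desingularization function $\chi(t)=c\,t^{1-\theta}$ for some $c>0$ and $\theta\in(0,1)$. Let $s_0<s_1<s_2<\cdots$ denote the successful iterations from some fixed successful iteration $s_0:=k_0\in\mathcal S$ onward. Then the sequence $\{s_{j+1}-s_j\}$ is bounded and the following statements hold: (a) If $\theta\in(0,\tfrac12)$, then $\{F(x^{s_k})\}$ converges Q-superlinearly to $F(x^* )$ with rate $\frac{1}{2\theta}$, and $\{x^{s_k}\}$ converges R-superlinearly to $x^*$ with the same rate. (b) If $\theta=\tfrac12$, then $\{F(x^{s_k})\}$ converges Q-linearly to $F(x^* )$, and $\{x^{s_k}\}$ converges R-linearly to $x^*$. (c) If $\theta\in(\tfrac12,1)$, then there exist constants $C_1,C_2>0$ such that for all sufficiently large $k$, $$F(x^{s_k})-F(x^*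 )\le C_1\,k^{-\frac{1}{2\theta-1}},\qquad \|x^{s_k}-x^*\|\le C_2\,k^{-\frac{1-\theta}{2\theta-1}} .$$
   Context: Problem: minimize $F(x):=f(x)+\varphi(x)$ over $x\in\mathbb{R}^n$, with $f:\mathbb{R}^n\to\mathbb{R}$ and $\varphi:\mathbb{R}^n\to\overline{\mathbb{R}}:=\mathbb{R}\cup\{\infty\}$. Here $\operatorname{dom}\varphi=\{x:\varphi(x)<\infty\}$; $\varphi$ is proper if $\operatorname{dom}\varphi\ne\emptyset$; $\varphi$ is prox-bounded if there exist $\gamma>0$ and $x\in\mathbb{R}^n$ with $\inf_{y}\{\varphi(y)+\frac{1}{2\gamma}\|y-x\|^2\}>-\infty$. As a standing assumption $F$ is proper and lower semicontinuous. $\partial$ denotes the limiting (Mordukhovich) subdifferential; $x$ is stationary if $0\in\partial F(x)$; $\mathbb{B}_\varepsilon(x)$ is the closed Euclidean ball; $\operatorname{dist}(x,C)=\inf_{y\in C}\|x-y\|$. Algorithm: parameters $c_1\in(0,1)$, $\sigma_2>1$, $0<\mu_{\min}\le\mu_{\max}<\infty$. Start with $x^0\in\operatorname{dom}\varphi$, a symmetric matrix $B_0\in\mathbb{R}^{n\times n}$ and $\mu_0\in[\mu_{\min},\mu_{\max}]$. For $k=0,1,2,\dots$ let $$q_k(x):=f(x^k)+\nabla f(x^k)^\top(x-x^k)+\tfrac12(x-x^k)^\top B_k(x-x^k)+\varphi(x),\quad G_k:=B_k+\mu_kI,\quad \hat q_k(x):=q_k(x)+\tfrac{\mu_k}{2}\|x-x^k\|^2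 .$$ Search for a global minimizer $\hat x^k$ of $\hat q_k$ over $\mathbb{R}^n$. If one is found, set $d^k:=\hat x^k-x^k$, $\mathrm{ared}_k:=F(x^k)-F(\hat x^k)$, $\mathrm{pred}_k:=F(x^k)-q_k(\hat x^k)$. If $\hat x^k$ is found and $\mathrm{ared}_k\ge c_1\,\mathrm{pred}_k$ (iteration $k$ is successful), set $x^{k+1}=\hat x^k$ and choose an arbitrary symmetric $B_{k+1}\in\mathbb{R}^{n\times n}$ and an arbitrary $\mu_{k+1}\in[\mu_{\min},\mu_{\max}]$. Otherwise (unsuccessful), set $x^{k+1}=x^k$, $B_{k+1}=B_k$, $\mu_{k+1}=\sigma_2\mu_k$. Standing assumption: whenever $\hat q_k$ has a minimizer, a minimizer $\hat x^k$ is found. $\mathcal S$ is the set of successful iterations; an accumulation point of $\{x^k\}_{k\in\mathcal S}$ is a limit of $\{x^k\}_{k\in\mathcal L}$ for some infinite $\mathcal L\subset\mathcal S$ (so $\mathcal S$ is infinite). KL property: a proper lower semicontinuous $g:\mathbb{R}^n\to\overline{\mathbb{R}}$ has the Kurdyka--\L{}ojasiewicz property at $x^*$ with $\partial g(x^* )\neq\emptyset$ if there exist $\eta>0$, a neighborhood $U$ of $x^*$ and a continuous concave function $\chi:[0,\eta]\to[0,\infty)$ (desingularization function), continuously differentiable on $(0,\eta)$, with $\chi(0)=0$ and $\chi'(t)>0$ for all $t\in(0,\eta)$, such that $\chi'(g(x)-g(x^* ))\operatorname{dist}(0,\partial g(x))\ge1$ for all $x\in U$ with $g(x^* )<g(x)<g(x^*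 )+\eta$. Rates: a sequence $a_k\to a$ converges Q-linearly if there is $r\in(0,1)$ with $\|a_{k+1}-a\|\le r\|a_k-a\|$ for all large $k$, and Q-superlinearly with rate $p>1$ if there is $C>0$ with $\|a_{k+1}-a\|\le C\|a_k-a\|^{p}$ for all large $k$. It converges R-linearly (R-superlinearly with rate $p$) if $\|a_k-a\|\le\epsilon_k$ for all large $k$, where $\{\epsilon_k\}\subset[0,\infty)$ converges to $0$ Q-linearly (Q-superlinearly with rate $p$). *)

(* Defs.v *)
From HB Require Import structures.
From mathcomp Require Import all_boot all_order all_algebra.
From mathcomp Require Import all_classical all_reals all_analysis.

Set Implicit Arguments.
Unset Strict Implicit.
Unset Printing Implicit Defensive.

Import Order.TTheory GRing.Theory Num.Theory.
Import numFieldNormedType.Exports.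

Local Open Scope classical_set_scope.
Local Open Scope ring_scope.

(* Vectors of R^n are rows 'rV[R]_n. The library norm on 'rV[R]_n is the sup
   norm; it is used only through the topology it induces (limits,
   neighborhoods, differentiability), which is the Euclidean one. Every norm
   that occurs in a formula is the Euclidean norm [enorm]. *)
Section Euclidean.
Context {R : realType} {n : nat}.
Implicit Types (x y : 'rV[R]_n) (A : 'M[R]_n) (C : set 'rV[R]_n).

Definition dotp x y : R := \sum_i x 0 i * y 0 i.

Definition enorm x : R := Num.sqrt (dotp x x).

Definition eball x (e : R) : set 'rV[R]_n := [set y | enorm (y - x) <= e].

(* equals +oo when C is empty *)
Definition dist_set x C : \bar R := ereal_inf [set (enorm (x - y))%:E | y in C].

Definition opnorm A : R :=
  sup [set enorm (x *m A) | x in [set x | enorm x <= 1]].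

Definition quadform A x : R := dotp (x *m A) x.

Definition grad (f : 'rV[R]_n -> R) x : 'rV[R]_n :=
  \row_i 'd f x (delta_mx 0 i).

Definition C1_on (O : set 'rV[R]_n) (f : 'rV[R]_n -> R) : Prop :=
  forall x, O x -> differentiable f x /\ {for x, continuous (grad f)}.

End Euclidean.

(* Functions with values in R \cup {+oo} are functions into \bar R; that they
   avoid -oo is a separate hypothesis. *)
Section ExtendedValued.
Context {R : realType} {n : nat}.
Implicit Types (g : 'rV[R]_n -> \bar R) (x v : 'rV[R]_n).
Local Open Scope ereal_scope.

Definition edom g : set 'rV[R]_n := [set x | g x < +oo].

Definition proper_fun g : Prop := edom g !=set0.

Definition prox_bounded g : Prop :=
  exists (gamma : R) (x : 'rV[R]_n), (0 < gamma)%R /\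
    -oo < ereal_inf
      (range (fun y => g y + ((2 * gamma)^-1 * enorm (y - x) ^+ 2)%:E)).

Definition global_minimizer g x : Prop := forall y, g x <= g y.

Definition regular_subdiff g x : set 'rV[R]_n := [set v |
  g x \is a fin_num /\
  0 <= limf_einf (fun y => (g y - g x - (dotp v (y - x))%:E)
                            * ((enorm (y - x))^-1)%:E) x^'].

Definition limiting_subdiff g x : set 'rV[R]_n := [set v |
  g x \is a fin_num /\
  exists (y w : nat -> 'rV[R]_n),
    [/\ y i @[i --> \oo] --> x,
        g (y i) @[i --> \oo] --> g x,
        forall i, regular_subdiff g (y i) (w i)
      & w i @[i --> \oo] --> v]].

Definition stationary g x : Prop := limiting_subdiff g x 0%R.

Definition desingularizing (eta : R) (chi : R -> R) : Prop :=
  [/\ {within `[0%R, eta], continuous chi},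
      forall t : R, (0 <= t <= eta)%R -> (0 <= chi t)%R,
      convex_function (`[0%R, eta]%classic : set R^o) (fun t => (- chi t)%R),
      chi 0%R = 0%R
    & forall t : R, (0 < t < eta)%R ->
        [/\ derivable chi t 1, {for t, continuous (derive1 chi)}
          & (0 < derive1 chi t)%R]].

Definition KL_property_with (chi : R -> R) g x : Prop :=
  limiting_subdiff g x !=set0 /\
  exists (eta : R) (U : set 'rV[R]_n),
    [/\ (0 < eta)%R, nbhs x U, desingularizing eta chi
      & forall y, U y -> g x < g y < g x + eta%:E ->
          1 <= (derive1 chi (fine (g y - g x)))%:E
               * dist_set 0%R (limiting_subdiff g y)].

End ExtendedValued.

Section Algorithm.
Context {R : realType} {n : nat}.
Context (f : 'rV[R]_n -> R) (phi : 'rV[R]_n -> \bar R).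
Local Open Scope ereal_scope.

Definition objective (x : 'rV[R]_n) : \bar R := (f x)%:E + phi x.

Definition qmodel (xk : 'rV[R]_n) (Bk : 'M[R]_n) (x : 'rV[R]_n) : \bar R :=
  (f xk + dotp (grad f xk) (x - xk) + 2^-1 * quadform Bk (x - xk))%:E + phi x.

Definition qhat xk Bk (muk : R) (x : 'rV[R]_n) : \bar R :=
  qmodel xk Bk x + (muk / 2 * enorm (x - xk) ^+ 2)%:E.

Definition ared (xk z : 'rV[R]_n) : \bar R := objective xk - objective z.

Definition predred xk Bk (z : 'rV[R]_n) : \bar R := objective xk - qmodel xk Bk z.

Context (c1 sigma2 mumin mumax : R).
(* [xhat k] is [Some z] when the minimizer z of the regularized model is found
   at iteration k, and [None] when no minimizer is found. *)
Context (x : nat -> 'rV[R]_n) (B : nat -> 'M[R]_n) (mu : nat -> R)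
  (xhat : nat -> option 'rV[R]_n).

Definition accepted (k : nat) (z : 'rV[R]_n) : Prop :=
  xhat k = Some z /\ c1%:E * predred (x k) (B k) z <= ared (x k) z.

Definition successful : set nat := [set k | exists z, accepted k z].

Record algorithm_run : Prop := AlgorithmRun {
  run_x0 : edom phi (x 0%N) ;
  run_B0 : (B 0%N)^T = B 0%N ;
  run_mu0 : (mumin <= mu 0%N <= mumax)%R ;
  run_found : forall k z, xhat k = Some z ->
    global_minimizer (qhat (x k) (B k) (mu k)) z ;
  run_not_found : forall k, xhat k = None ->
    ~ exists z, global_minimizer (qhat (x k) (B k) (mu k)) z ;
  run_success : forall k z, accepted k z ->
    [/\ x k.+1 = z, (B k.+1)^T = B k.+1 & (mumin <= mu k.+1 <= mumax)%R] ;
  run_failure : forall k, ~ successful k ->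
    [/\ x k.+1 = x k, B k.+1 = B k & mu k.+1 = (sigma2 * mu k)%R]
}.

End Algorithm.

(* L = range l is the infinite index set along which x converges *)
Definition accumulation_point_along {R : realType} {n : nat} (S : set nat)
    (x : nat -> 'rV[R]_n) (a : 'rV[R]_n) : Prop :=
  exists l : nat -> nat,
    [/\ {homo l : i j / (i < j)%N}, forall i, S (l i)
      & x (l i) @[i --> \oo] --> a].

Definition enumerates_from (S : set nat) (k0 : nat) (s : nat -> nat) : Prop :=
  [/\ s 0%N = k0, {homo s : i j / (i < j)%N}
    & range s = S `&` [set k | (k0 <= k)%N]].

Section Rates.
Context {R : realType}.

Definition Q_linear (a : nat -> R) (l : R) : Prop :=
  a i @[i --> \oo] --> l /\
  exists r : R, 0 < r < 1 /\
    \forall k \near \oo, `|a k.+1 - l| <= r * `|a k - l|.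

Definition Q_superlinear (p : R) (a : nat -> R) (l : R) : Prop :=
  a i @[i --> \oo] --> l /\
  exists C : R, 0 < C /\
    \forall k \near \oo, `|a k.+1 - l| <= C * `|a k - l| `^ p.

Definition R_linear {n : nat} (a : nat -> 'rV[R]_n) (l : 'rV[R]_n) : Prop :=
  exists e : nat -> R,
    [/\ forall k, 0 <= e k, Q_linear e 0
      & \forall k \near \oo, enorm (a k - l) <= e k].

Definition R_superlinear {n : nat} (p : R) (a : nat -> 'rV[R]_n)
    (l : 'rV[R]_n) : Prop :=
  exists e : nat -> R,
    [/\ forall k, 0 <= e k, Q_superlinear p e 0
      & \forall k \near \oo, enorm (a k - l) <= e k].

End Rates.

(* Main.v *)
Require Import Defs.
From HB Require Import structures.
From mathcomp Require Import all_boot all_order all_algebra.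
From mathcomp Require Import all_classical all_reals all_analysis.
From mathcomp Require Import zify ring lra.

Set Implicit Arguments.
Unset Strict Implicit.
Unset Printing Implicit Defensive.

Import Order.TTheory GRing.Theory Num.Def Num.Theory.
Import numFieldNormedType.Exports.

Local Open Scope classical_set_scope.
Local Open Scope ring_scope.

(** Write [y j] for the [j]-th successful iterate, [d j] for the length of the
step from [y j] to [y j.+1], [r j] for [F (y j) - F xstar].

Local analysis of the algorithm. Around [xstar] the gradient of [f] is
Lipschitz continuous on a ball, so the descent lemma holds there. Because [phi]
is prox-bounded, a large regularization parameter makes the model coercive: it
then has a minimizer, which is close to its center ([sublevel_small],
[minimizer_exists]), and by the descent lemma the ratio test succeeds
([ratio_test_large_mu]). Hence the parameter stays bounded at every iterate near
[xstar] ([large_mu_success], [mu_le_near]), and the number of consecutive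
failures there is bounded ([failures_bounded]). With a bounded parameter, Fermat's
rule for the model yields a subgradient of [F] at [y j.+1] of norm at most a
constant times [d j] ([minimizer_regular_subdiff], [success_subgradient]), and
comparing the model at its minimizer and at [xstar] shows that the values
decrease to [F xstar] ([value_to_limit]).

Abstract descent argument. The ratio test gives [a * d j ^+ 2 <= r j - r j.+1]
([iterate_decrease]), and the Kurdyka-Lojasiewicz inequality at [y j.+1] gives
[r j.+1 `^ theta <= K * d j] ([success_KL]). By the concavity of
[t `^ (1 - theta)], the potential [V j = d j + E * r j.+1 `^ (1 - theta)], with
[E = K / (a * (1 - theta))], satisfies [d j.+1 + V j.+1 <= V j]
([potential_step]). Therefore the distance of [y j.+1] to [xstar] plus [V j] is
nonincreasing, so that the sequence never leaves a small ball around [xstar] once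
this sum is small, and the distance of [y j.+1] to [xstar] is at most [V j]
([finite_length]).

Rates. The two inequalities combine into
[r j.+1 `^ (2 * theta) <= K ^+ 2 / a * (r j - r j.+1)]. This recursion gives the
three rates for the values; the bound by [V j], together with
[a * d j ^+ 2 <= r j], transfers them to the iterates
([superlinear_rate], [linear_rate], [sublinear_rate]). *)

(** * Euclidean norm and inner product *)

Section EuclideanTheory.
Context {R : realType} {n : nat}.
Implicit Types (x y z : 'rV[R]_n) (A : 'M[R]_n).

Lemma dotpC x y : dotp x y = dotp y x.
Proof. by apply: eq_bigr => i _; rewrite mulrC. Qed.

Lemma dotpDl x y z : dotp (x + y) z = dotp x z + dotp y z.
Proof. by rewrite -big_split; apply: eq_bigr => i _; rewrite mxE mulrDl. Qed.

Lemma dotpZl (a : R) x y : dotp (a *: x) y = a * dotp x y.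
Proof. by rewrite mulr_sumr; apply: eq_bigr => i _; rewrite mxE mulrA. Qed.

Lemma dotpNl x y : dotp (- x) y = - dotp x y.
Proof. by rewrite -scaleN1r dotpZl mulN1r. Qed.

Lemma dotpBl x y z : dotp (x - y) z = dotp x z - dotp y z.
Proof. by rewrite dotpDl dotpNl. Qed.

Lemma dotpDr x y z : dotp x (y + z) = dotp x y + dotp x z.
Proof. by rewrite dotpC dotpDl !(dotpC _ x). Qed.

Lemma dotpNr x y : dotp x (- y) = - dotp x y.
Proof. by rewrite dotpC dotpNl dotpC. Qed.

Lemma dotpBr x y z : dotp x (y - z) = dotp x y - dotp x z.
Proof. by rewrite dotpDr dotpNr. Qed.

Lemma dotpZr (a : R) x y : dotp x (a *: y) = a * dotp x y.
Proof. by rewrite dotpC dotpZl dotpC. Qed.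

Lemma dotp0r x : dotp x 0 = 0.
Proof. by rewrite -(scale0r 0) dotpZr mul0r. Qed.

Lemma dotp_ge0 x : 0 <= dotp x x.
Proof. by apply: sumr_ge0 => i _; rewrite -expr2 sqr_ge0. Qed.

Lemma enorm_ge0 x : 0 <= enorm x.
Proof. exact: sqrtr_ge0. Qed.

Lemma sqr_enorm x : enorm x ^+ 2 = dotp x x.
Proof. by rewrite sqr_sqrtr// dotp_ge0. Qed.

Lemma enorm0 : enorm (0 : 'rV[R]_n) = 0.
Proof. by rewrite /enorm dotp0r sqrtr0. Qed.

Lemma enormZ (a : R) x : enorm (a *: x) = `|a| * enorm x.
Proof.
rewrite /enorm dotpZl dotpZr mulrA -expr2 sqrtrM ?sqr_ge0//.
by rewrite sqrtr_sqr.
Qed.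

Lemma enormN x : enorm (- x) = enorm x.
Proof. by rewrite /enorm dotpNl dotpNr opprK. Qed.

Lemma enorm_distC x y : enorm (x - y) = enorm (y - x).
Proof. by rewrite -enormN opprB. Qed.

Lemma coord_le_enorm x i : `|x 0 i| <= enorm x.
Proof.
rewrite -sqrtr_sqr ler_wsqrtr// /dotp (bigD1 i)//= expr2 lerDl.
by apply: sumr_ge0 => j _; rewrite -expr2 sqr_ge0.
Qed.

Lemma enorm_eq0 x : enorm x = 0 -> x = 0.
Proof.
move=> x0; apply/rowP => i; rewrite mxE; apply/eqP.
by rewrite -normr_le0 -x0 coord_le_enorm.
Qed.

(** Expand the square of [enorm y *: x - enorm x *: y]. *)
Lemma cauchy_schwarz x y : dotp x y <= enorm x * enorm y.
Proof.
have [/enorm_eq0 -> | x0] := eqVneq (enorm x) 0.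
  by rewrite dotpC dotp0r enorm0 mul0r.
have [/enorm_eq0 -> | y0] := eqVneq (enorm y) 0.
  by rewrite dotp0r enorm0 mulr0.
have xy : 0 < enorm x * enorm y by rewrite mulr_gt0// lt0r ?x0 ?y0 enorm_ge0.
have := dotp_ge0 (enorm y *: x - enorm x *: y).
rewrite dotpBl !dotpBr !dotpZl !dotpZr (dotpC y x) -!sqr_enorm => h.
by rewrite -(ler_pM2l xy); nra.
Qed.

Lemma norm_dotp_le x y : `|dotp x y| <= enorm x * enorm y.
Proof.
rewrite ler_norml cauchy_schwarz andbT lerNl -dotpNl.
by rewrite (le_trans (cauchy_schwarz _ _))// enormN.
Qed.

Lemma enormD x y : enorm (x + y) <= enorm x + enorm y.
Proof.
rewrite -(ler_pXn2r (n := 2))// ?nnegrE ?addr_ge0 ?enorm_ge0//.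
rewrite sqrrD !sqr_enorm dotpDl !dotpDr (dotpC y x).
by have := cauchy_schwarz x y; lra.
Qed.

Lemma enormB x y : enorm (x - y) <= enorm x + enorm y.
Proof. by rewrite (le_trans (enormD _ _))// enormN. Qed.

Lemma enorm_triangle y x z : enorm (x - z) <= enorm (x - y) + enorm (y - z).
Proof. by rewrite (le_trans _ (enormD _ _))// addrA subrK. Qed.

(** The Euclidean norm and the sup norm are equivalent, hence Euclidean balls
form a basis of neighborhoods. *)
Lemma enorm_le_norm x : enorm x <= n%:R * `|x|.
Proof.
rewrite -(ler_pXn2r (n := 2))// ?nnegrE ?enorm_ge0 ?mulr_ge0//.
rewrite sqr_enorm /dotp.
have coord i : `|x 0 i| <= `|x|.
  rewrite [leRHS]/normr/= mx_normrE.
  by apply/bigmax_geP; right => /=; exists (0, i).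
apply: (@le_trans _ _ (\sum_(i < n) `|x| ^+ 2)).
  apply: ler_sum => i _; rewrite -expr2 -real_normK ?num_real//.
  by rewrite ler_pXn2r ?nnegrE.
rewrite sumr_const card_ord -[leLHS]mulr_natl [leRHS]exprMn. rewrite ler_wpM2r ?sqr_ge0//.
by case: (n) => [|m]; rewrite ?expr0n// -natrX ler_nat expnS expn1 leq_pmulr.
Qed.

Lemma norm_le_enorm x : `|x| <= enorm x.
Proof.
rewrite [leLHS]/normr/= mx_normrE; apply/bigmax_leP; split.
  exact: enorm_ge0.
by move=> [i j] _ /=; rewrite (ord1 i) coord_le_enorm.
Qed.

Lemma nbhs_eball x (e : R) : 0 < e -> nbhs x (eball x e).
Proof.
move=> e0; apply/(@nbhs_normP _ 'rV[R]_n); exists (e / n.+1%:R) => /=; first by rewrite divr_gt0.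
move=> y /=; rewrite ltr_pdivlMr// => yx; rewrite /eball/= enorm_distC.
apply: le_trans (enorm_le_norm _) (le_trans _ (ltW yx)).
by rewrite mulrC ler_wpM2l// ler_nat.
Qed.

Lemma eball_nbhs x (U : set 'rV[R]_n) :
  nbhs x U -> exists2 e : R, 0 < e & eball x e `<=` U.
Proof.
move=> /(@nbhs_normP _ 'rV[R]_n)[e /= e0 eU]; exists (e / 2); first by rewrite divr_gt0.
move=> y yx; apply: eU => /=; rewrite distrC.
apply: le_lt_trans (norm_le_enorm _) (le_lt_trans yx _).
by rewrite ltr_pdivrMr// ltr_pMr// ltr1n.
Qed.

(** The set defining [opnorm A] is bounded above, so that its supremum is an
upper bound. *)
Lemma enorm_mulmx_bounded A : exists M : R, forall x, enorm (x *m A) <= M * enorm x.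
Proof.
exists (n%:R * \sum_j \sum_i `|A i j|) => x.
apply: le_trans (enorm_le_norm _) _; rewrite -mulrA ler_wpM2l//.
rewrite [leLHS]/normr/= mx_normrE; apply/bigmax_leP; split.
  by rewrite mulr_ge0 ?enorm_ge0// sumr_ge0// => j _; rewrite sumr_ge0.
move=> [i j] _ /=; rewrite (ord1 i) mxE (le_trans (ler_norm_sum _ _ _))//.
apply: (@le_trans _ _ ((\sum_i `|A i j|) * enorm x)).
  rewrite mulr_suml; apply: ler_sum => k _.
  by rewrite normrM mulrC ler_wpM2l// coord_le_enorm.
rewrite ler_wpM2r ?enorm_ge0// [leRHS](bigD1 j)//= lerDl sumr_ge0// => k _.
by rewrite sumr_ge0.
Qed.

Lemma enorm_mulmx_le A x : enorm (x *m A) <= opnorm A * enorm x.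
Proof.
have [M hM] := enorm_mulmx_bounded A.
have [/enorm_eq0 -> | x0] := eqVneq (enorm x) 0.
  by rewrite mul0mx enorm0 mulr0.
have xp : 0 < enorm x by rewrite lt0r x0 enorm_ge0.
rewrite -ler_pdivrMr//.
have -> : enorm (x *m A) / enorm x = enorm (((enorm x)^-1 *: x) *m A).
  by rewrite -scalemxAl enormZ ger0_norm ?invr_ge0 ?enorm_ge0// mulrC.
apply: ub_le_sup.
  exists (`|M|) => _ [z /= z1 <-]; apply: le_trans (hM z) _.
  apply: le_trans (ler_norm _) _; rewrite normrM (ger0_norm (enorm_ge0 z)).
  by rewrite ler_piMr.
exists ((enorm x)^-1 *: x) => //=.
by rewrite enormZ ger0_norm ?invr_ge0 ?enorm_ge0// mulVf.
Qed.

Lemma norm_quadform_le A x (M : R) :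
  opnorm A <= M -> `|quadform A x| <= M * enorm x ^+ 2.
Proof.
move=> AM; apply: le_trans (norm_dotp_le _ _) _.
rewrite expr2 mulrA ler_wpM2r ?enorm_ge0//.
by apply: le_trans (enorm_mulmx_le _ _) _; rewrite ler_wpM2r ?enorm_ge0.
Qed.

Lemma dotp_mulmx_sym A x y : A^T = A -> dotp (x *m A) y = dotp (y *m A) x.
Proof.
have tr u v : dotp u v = (u *m v^T) 0 0.
  by rewrite mxE; apply: eq_bigr => i _; rewrite mxE.
move=> As; rewrite (dotpC (y *m A)) !tr trmx_mul As mulmxA //.
Qed.

Lemma quadformD A x y : A^T = A ->
  quadform A (x + y) = quadform A x + 2 * dotp (x *m A) y + quadform A y.
Proof.
move=> As; rewrite /quadform mulmxDl dotpDl !dotpDr (dotp_mulmx_sym y x As).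
by ring.
Qed.

Lemma cvg_sumr (T : Type) (G : set_system T) {FG : Filter G} (I : Type)
    (l : seq I) (g : I -> T -> R) (a : I -> R) :
  (forall i, g i @ G --> a i) ->
  (fun t => \sum_(i <- l) g i t) @ G --> \sum_(i <- l) a i.
Proof.
move=> ga; elim: l => [|i l IH].
  by under eq_fun do rewrite big_nil; rewrite big_nil; exact: cvg_cst.
by under eq_fun do rewrite big_cons; rewrite big_cons; exact: cvgD.
Qed.

Lemma continuous_dotp (T : topologicalType) (u v : T -> 'rV[R]_n) (t : T) :
  (forall i, {for t, continuous (fun s => u s 0 i)}) ->
  (forall i, {for t, continuous (fun s => v s 0 i)}) ->
  {for t, continuous (fun s => dotp (u s) (v s))}.
Proof.
move=> cu cv; rewrite /dotp /continuous_at; apply: cvg_sumr => i.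
by apply: cvgM; [exact: cu|exact: cv].
Qed.

Lemma continuous_coordB (a : 'rV[R]_n) i : continuous (fun y => (y - a) 0 i).
Proof.
move=> y; rewrite (_ : (fun _ => _) = (fun z : 'rV[R]_n => z 0 i) - cst (a 0 i)).
  by apply: continuousB; [exact: coord_continuous|exact: cst_continuous].
by apply/funext => z; rewrite !mxE.
Qed.

Lemma continuous_coord_mulmx A (T : topologicalType) (u : T -> 'rV[R]_n) (t : T) :
  (forall i, {for t, continuous (fun s => u s 0 i)}) ->
  forall i, {for t, continuous (fun s => (u s *m A) 0 i)}.
Proof.
move=> cu i; suff : (fun s => \sum_j u s 0 j * A j i) @ t --> \sum_j u t 0 j * A j i.
  have -> : (fun s => \sum_j u s 0 j * A j i) = (fun s => (u s *m A) 0 i).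
    by apply/funext => z; rewrite mxE.
  by have -> : \sum_j u t 0 j * A j i = (u t *m A) 0 i by rewrite mxE.
by apply: cvg_sumr => j; apply: cvgM; [exact: cu|exact: cvg_cst].
Qed.

Lemma continuous_enorm_sub (a : 'rV[R]_n) : continuous (fun y => enorm (y - a)).
Proof.
move=> y; rewrite /enorm.
apply: (@continuous_comp _ _ _ (fun y : 'rV[R]_n => dotp (y - a) (y - a)) sqrtr).
  by apply: continuous_dotp => i; exact: continuous_coordB.
exact: sqrt_continuous.
Qed.

Lemma compact_eball (a : 'rV[R]_n) (e : R) : compact (eball a e).
Proof.
apply: bounded_closed_compact.
  exists (`|a| + e); split; first exact: num_real.
  move=> M hM y ya; apply: le_trans (ltW hM).
  rewrite -[y in `|y|](subrK a) addrC (le_trans (ler_normD _ _))// lerD2l.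
  exact: le_trans (norm_le_enorm _) ya.
rewrite (_ : eball a e = (fun y => enorm (y - a)) @^-1` [set t : R | t <= e])//.
by apply: preimage_closed => [y _|]; [exact: continuous_enorm_sub|exact: closed_le].
Qed.

End EuclideanTheory.

(** * Minimization of lower semicontinuous functions *)

Section Minimization.
Context {R : realType}.

(** The sublevel sets [B y] of [h] through the points [y] of [K] form a filter
base; any cluster point of it in [K] is a minimizer. *)
Lemma lsc_attains_min (T : topologicalType) (K : set T) (h : T -> \bar R) :
  compact K -> K !=set0 -> lower_semicontinuous h -> (forall y, h y != -oo%E) ->
  exists2 z, K z & forall y, K y -> (h z <= h y)%E.
Proof.
move=> cK [y0 Ky0] lsch hNy.
pose B y : set T := [set z | K z /\ (h z <= h y)%E].
have FF : Filter (filter_from K B).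
  apply: filter_from_filter; first by exists y0.
  move=> y z Ky Kz; case: (leP (h y) (h z)) => yz.
    by exists y => // w [Kw wy]; split; split => //; exact: le_trans yz.
  by exists z => // w [Kw wz]; split; split => //; exact: le_trans (ltW yz).
have PF : ProperFilter (filter_from K B).
  by apply: filter_from_proper => y Ky; exists y; split.
have [|p [Kp clp]] := cK _ PF; first by exists y0 => // z [].
exists p => // y Ky; rewrite leNgt; apply/negP => yp.
case hy: (h y) yp (hNy y) => [r| |] // rp _; last by rewrite ltNge leey in rp.
have [V Vp hV] := lsch p r rp.
have [w [[_ wy] Vw]] := clp (B y) V (ex_intro2 _ _ y Ky (fun z => id)) Vp.
by move: (hV w Vw); rewrite ltNge -hy wy.
Qed.

Lemma lsc_add_continuous (T : topologicalType) (h : T -> \bar R) (p : T -> R) :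
  (forall y, h y != -oo%E) -> lower_semicontinuous h -> continuous p ->
  lower_semicontinuous (fun y => h y + (p y)%:E)%E.
Proof.
move=> hNy lsch cp x a ahp.
(* Split the gap between [a] and [h x + p x] between [h] and [p]. *)
have [e e0 [r rh re]] : exists2 e : R, 0 < e &
    exists2 r : R, (r%:E < h x)%E & a <= r + (p x - e).
  case hx: (h x) ahp (hNy x) => [r| |] //; last first.
    by move=> _ _; exists 1 => //; exists (a - p x + 1); [rewrite ltry|lra].
  rewrite -EFinD lte_fin => ar _; pose e := (r + p x - a) / 2.
  have e0 : 0 < e by rewrite divr_gt0// subr_gt0.
  by exists e => //; exists (r - e); rewrite ?lte_fin /e; lra.
have [V Vx hV] := lsch x r rh.
have Wx : nbhs x [set y | `|p x - p y| < e].
  by have /cvgrPdist_lt/(_ _ e0) := cp x.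
exists (V `&` [set y | `|p x - p y| < e]); first exact: filterI.
move=> y [/hV hy /= py].
have {}py : a <= r + p y by move: py; rewrite ltr_norml => /andP[]; lra.
apply: le_lt_trans (_ : ((r + p y)%:E < _)%E); first by rewrite lee_fin.
by rewrite EFinD lteD2rE.
Qed.

End Minimization.

(** * Gradients and the descent lemma *)

Section Differential.
Context {R : realType} {n : nat}.
Implicit Types (f : 'rV[R]_n -> R) (x z : 'rV[R]_n).

Lemma diff_grad f x v : differentiable f x -> 'd f x v = dotp (grad f x) v.
Proof.
move=> df; rewrite [in LHS](row_sum_delta v) linear_sum/=.
by apply: eq_bigr => i _; rewrite linearZ/= mulrC !mxE.
Qed.

(** The mean value theorem along the segment from [x] to [z]. *)
Lemma mvt_grad f x z :
  (forall t : R, 0 <= t <= 1 -> differentiable f (x + t *: (z - x))) ->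
  exists2 t : R, 0 <= t <= 1 &
    f z - f x = dotp (grad f (x + t *: (z - x))) (z - x).
Proof.
move=> df; pose d := z - x; pose g (t : R) := f (x + t *: d).
have gE (t : R) : (fun h : R => h^-1 *: (g (h *: 1 + t) - g t)) =
    (fun h : R => h^-1 *: (f (h *: d + (x + t *: d)) - f (x + t *: d))).
  apply/funext => h; rewrite /g; congr (_ *: (f _ - _)).
  have -> : h *: (1 : R) = h by exact: mulr1.
  by rewrite scalerDl addrCA.
have dg (t : R) : 0 <= t <= 1 ->
    is_derive t 1 g (dotp (grad f (x + t *: d)) d).
  move=> t01; split.
    by rewrite /derivable gE; exact/diff_derivable/df.
  by rewrite /derive gE -diff_grad; [exact/deriveE/df|exact: df].
have [t t01] : exists2 t : R, t \in `[0, 1] &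
    g 1 - g 0 = dotp (grad f (x + t *: d)) d * (1 - 0).
  apply: (@MVT_segment R g (fun t => dotp (grad f (x + t *: d)) d)) => //.
    by move=> t; rewrite in_itv/= => /andP[t0 t1]; apply: dg; rewrite !ltW.
  apply: derivable_within_continuous => t; rewrite in_itv/= => t01.
  by have [] := dg t t01.
rewrite subr0 mulr1 /g scale1r scale0r addr0 /d subrKC => ->.
by exists t => //; move: t01; rewrite in_itv.
Qed.

Lemma eball_segment x0 (e : R) x z (t : R) : eball x0 e x -> eball x0 e z ->
  0 <= t <= 1 -> eball x0 e (x + t *: (z - x)).
Proof.
rewrite /eball/= => xe ze /andP[t0 t1].
have -> : x + t *: (z - x) - x0 = (1 - t) *: (x - x0) + t *: (z - x0).
  by apply/rowP => i; rewrite !mxE; ring.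
apply: le_trans (enormD _ _) _.
rewrite !enormZ !ger0_norm ?subr_ge0//.
by have t1' : 0 <= 1 - t; [rewrite subr_ge0|nra].
Qed.

(** The descent lemma. The constant [L] in place of [L / 2] spares an
integration and suffices for all later estimates. *)
Lemma descent f x0 (e L : R) x z :
  (forall y, eball x0 e y -> differentiable f y) ->
  (forall y w, eball x0 e y -> eball x0 e w ->
     enorm (grad f y - grad f w) <= L * enorm (y - w)) ->
  0 <= L -> eball x0 e x -> eball x0 e z ->
  `|f z - f x - dotp (grad f x) (z - x)| <= L * enorm (z - x) ^+ 2.
Proof.
move=> df lipf L0 xe ze.
have [t t01 ->] : exists2 t : R, 0 <= t <= 1 &
    f z - f x = dotp (grad f (x + t *: (z - x))) (z - x).
  by apply: mvt_grad => t t01; apply: df; exact: eball_segment.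
rewrite -dotpBl (le_trans (norm_dotp_le _ _))// expr2 mulrA.
rewrite ler_wpM2r ?enorm_ge0//.
rewrite (le_trans (lipf _ _ (eball_segment xe ze t01) xe))//.
rewrite addrC addKr enormZ; case/andP: t01 => t0 t1; rewrite ger0_norm// mulrA.
by rewrite ler_wpM2r ?enorm_ge0// ler_piMr.
Qed.

(** The first-order lower expansion, in the Euclidean norm. *)
Lemma diff_lower f z (e : R) : differentiable f z -> 0 < e ->
  \forall y \near z, - e * enorm (y - z) <= f y - f z - dotp (grad f z) (y - z).
Proof.
move=> df e0; have /eqaddoP/(_ e e0) := diff_locally df.
move=> /(@nbhs_normP R 'rV[R]_n)[d /= d0 hd].
apply/(@nbhs_normP R 'rV[R]_n); exists d => // y /= zy.
have := hd (y - z); rewrite /= sub0r opprB => /(_ zy) fy.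
rewrite mulNr lerNl -diff_grad//.
apply: le_trans (ler_norm _) _; rewrite normrN.
apply: le_trans (le_trans _ fy) _; last by rewrite ler_pM2l// norm_le_enorm.
by rewrite !fctE/= subrK opprD addrA.
Qed.

End Differential.

(** * Inequalities for real powers *)

Section PowerInequalities.
Context {R : realType}.
Implicit Types (r s t theta : R).

Lemma powR_mul_onem r theta : 0 <= r -> r `^ theta * r `^ (1 - theta) = r.
Proof.
move=> r0; rewrite -powRD; first by rewrite addrC subrK powRr1.
by rewrite addrC subrK oner_eq0.
Qed.

Lemma weighted_amgm r s theta : 0 <= r -> 0 <= s -> 0 < theta < 1 ->
  r `^ theta * s `^ (1 - theta) <= theta * r + (1 - theta) * s.
Proof.
move=> r0 s0 /andP[t0 t1]; have u0 : 0 < 1 - theta by rewrite subr_gt0.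
have := @conjugate_powR R (r `^ theta) (s `^ (1 - theta)) theta^-1 (1 - theta)^-1.
rewrite !powR_ge0 !invr_gt0 !invrK -!powRrM !mulfV ?gt_eqF// !powRr1//.
rewrite (mulrC r) (mulrC s); apply => //.
by rewrite addrC subrK.
Qed.

(** The tangent inequality for the concave function [t `^ (1 - theta)] at [r],
multiplied by [r `^ theta] so that it also holds at [r = 0]. *)
Lemma concave_gap r s theta : 0 <= r -> 0 <= s -> 0 < theta < 1 ->
  (1 - theta) * (r - s) <= r `^ theta * (r `^ (1 - theta) - s `^ (1 - theta)).
Proof.
move=> r0 s0 t01; rewrite [leRHS]mulrBr powR_mul_onem//.
by have := weighted_amgm r0 s0 t01; lra.
Qed.

Lemma le_powR p r s : 0 <= p -> 0 <= r -> r <= s -> r `^ p <= s `^ p.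
Proof.
move=> p0 r0 rs; apply: ge0_ler_powR => //; rewrite nnegrE//.
exact: le_trans rs.
Qed.

(** The convex function [(1 + t) `^ p] lies below its chord on [[0, 1]]. *)
Lemma powR_chord p t : 1 <= p -> 0 <= t <= 1 ->
  (1 + t) `^ p <= 1 + (2 `^ p - 1) * t.
Proof.
move=> p1 /andP[t0 t1].
have := convex_powR p1 (Itv01 t0 t1) (x := 2) (y := 1).
rewrite !inE/= !in_itv/= ler0n ler01 => /(_ isT isT).
rewrite [X in X `^ _ <= _ -> _]convRE [X in _ <= X -> _]convRE/= /unstable.onem powR1.
have -> : t * 2 + (1 - t) * 1 = 1 + t by ring.
by move/le_trans; apply; lra.
Qed.

End PowerInequalities.

(** * Finite length under the Kurdyka-Lojasiewicz inequality *)

Section FiniteLength.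
Context {R : realType} {n : nat}.
Context (y : nat -> 'rV[R]_n) (r : nat -> R) (xs : 'rV[R]_n).
Context (a K theta rho eta : R).
Hypotheses (a0 : 0 < a) (K0 : 0 < K) (theta01 : 0 < theta < 1).
Hypotheses (rho0 : 0 < rho) (eta0 : 0 < eta).
Hypothesis r_ge0 : forall j, 0 <= r j.
Hypothesis r_decrease : forall j,
  a * enorm (y j.+1 - y j) ^+ 2 <= r j - r j.+1.
Hypothesis r_KL : forall j,
  enorm (y j - xs) < rho -> enorm (y j.+1 - xs) < rho -> r j.+1 < eta ->
  r j.+1 `^ theta <= K * enorm (y j.+1 - y j).
Hypothesis y_acc : forall (e : R) N, 0 < e ->
  exists2 j, (N <= j)%N & enorm (y j - xs) < e.
Hypothesis r_small : forall e : R, 0 < e -> exists j, r j < e.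

Let d j := enorm (y j.+1 - y j).
Let E := K / (a * (1 - theta)).
(** The potential whose decrease controls the length of the trajectory. *)
Let V j := d j + E * r j.+1 `^ (1 - theta).

Lemma decrease_noninc i j : (i <= j)%N -> r j <= r i.
Proof.
elim: j => [|j IH]; first by rewrite leqn0 => /eqP->.
rewrite leq_eqVlt => /predU1P[->//|]; rewrite ltnS => /IH; apply: le_trans.
rewrite -subr_ge0; apply: le_trans (r_decrease j).
by rewrite mulr_ge0 ?sqr_ge0// ltW.
Qed.

Lemma length_const_gt0 : 0 < E.
Proof. by case/andP: theta01 => _ ?; rewrite divr_gt0 ?mulr_gt0 ?subr_gt0. Qed.

Lemma potential_ge0 j : 0 <= V j.
Proof. by rewrite addr_ge0 ?enorm_ge0// mulr_ge0 ?powR_ge0// ltW// length_const_gt0. Qed.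

(** The potential decreases by at least the length of the next step. With [D]
the decrease of [r `^ (1 - theta)], sufficient decrease and the hypothesis give
[d j.+1 ^+ 2 <= d j * (E * D)], and the geometric mean is at most the arithmetic
mean. *)
Lemma potential_step j : r j.+1 `^ theta <= K * d j -> d j.+1 + V j.+1 <= V j.
Proof.
move=> kl; case/andP: (theta01) => t0 t1.
set D := r j.+1 `^ (1 - theta) - r j.+2 `^ (1 - theta).
have D0 : 0 <= D.
  by rewrite subr_ge0 le_powR ?subr_ge0 ?(ltW t1)// decrease_noninc.
have gap := concave_gap (r_ge0 j.+1) (r_ge0 j.+2) theta01.
have dj : 0 <= d j := enorm_ge0 _.
have dj1 : 0 <= d j.+1 := enorm_ge0 _.
have le1 : (1 - theta) * (a * d j.+1 ^+ 2) <= K * d j * D.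
  apply: le_trans (le_trans gap _); last by rewrite ler_wpM2r.
  by rewrite ler_pM2l ?subr_gt0//; exact: r_decrease.
have le2 : d j.+1 ^+ 2 <= d j * (E * D).
  rewrite /E -(ler_pM2l (_ : 0 < a * (1 - theta))); last first.
    by rewrite mulr_gt0 ?subr_gt0.
  rewrite (_ : _ * (d j * _) = K * d j * D); first by move: le1; lra.
  by field; rewrite !gt_eqF ?subr_gt0.
have ED : 0 <= E * D by rewrite mulr_ge0// ltW// length_const_gt0.
suff : 2 * d j.+1 <= d j + E * D by rewrite /V /D; lra.
rewrite leNgt; apply/negP => lt.
have : (d j + E * D) ^+ 2 < (2 * d j.+1) ^+ 2.
  by rewrite ltr_pXn2r ?nnegrE ?mulr_ge0 ?addr_ge0.
by have := sqr_ge0 (d j - E * D); nra.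
Qed.

(** The sum of the distance to [xs] and the potential does not increase, which
keeps the sequence in the ball where the Kurdyka-Lojasiewicz inequality holds. *)
Lemma ball_invariant_step j : r j.+1 < eta ->
  enorm (y j - xs) < rho -> enorm (y j.+1 - xs) + V j < rho ->
  enorm (y j.+1 - xs) < rho /\ enorm (y j.+2 - xs) + V j.+1 < rho.
Proof.
move=> rj yj yVj.
have yj1 : enorm (y j.+1 - xs) < rho by have := potential_ge0 j; lra.
split=> //; have := potential_step (r_KL yj yj1 rj).
have := enorm_triangle (y j.+1) (y j.+2) xs; rewrite -/(d j.+1).
lra.
Qed.

Lemma ball_invariant_start : exists J, [/\ r J < eta, enorm (y J - xs) < rho
  & enorm (y J.+1 - xs) + V J < rho].
Proof.
case/andP: theta01 => t0 t1; have u0 : 0 < 1 - theta by rewrite subr_gt0.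
(* [del] solves [E * del `^ (1 - theta) = rho / 4]. *)
pose del := (rho / 4 / E) `^ (1 - theta)^-1.
have rE : 0 < rho / 4 / E by apply: divr_gt0 length_const_gt0; rewrite divr_gt0.
have del0 : 0 < del by rewrite powR_gt0.
have e0 : 0 < Num.min eta (Num.min del (a * (rho / 4) ^+ 2)).
  by rewrite !lt_min eta0 del0 mulr_gt0// exprn_gt0// divr_gt0.
have [N] := r_small e0; rewrite !lt_min => /and3P[Neta Ndel Na].
have [J NJ yJ] := @y_acc (rho / 4) N (divr_gt0 rho0 (ltr0n _ 4)).
have rJ := decrease_noninc NJ; have rJ1 := decrease_noninc (leqW NJ).
exists J; split; [exact: le_lt_trans Neta|by move: yJ rho0; lra|].
have dJ : d J < rho / 4.
  rewrite -(ltr_pXn2r (n := 2))// ?nnegrE ?enorm_ge0 ?divr_ge0 ?(ltW rho0)//.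
  rewrite -(ltr_pM2l a0); apply: le_lt_trans (r_decrease J) _.
  by have := r_ge0 J.+1; lra.
have EJ : E * r J.+1 `^ (1 - theta) < rho / 4.
  rewrite mulrC -ltr_pdivlMr ?length_const_gt0//.
  have -> : rho / 4 / E = del `^ (1 - theta).
    by rewrite -powRrM mulVf ?gt_eqF// powRr1// ltW.
  apply: gt0_ltr_powR => //; rewrite ?nnegrE ?(ltW del0)//.
  exact: le_lt_trans Ndel.
have := enorm_triangle (y J) (y J.+1) xs; rewrite -/(d J) /V; lra.
Qed.

(** Eventually the sequence stays in the ball, the Kurdyka-Lojasiewicz
inequality holds at each step, and the distance to [xs] is bounded by the
potential. *)
Lemma finite_length : exists J, forall j, (J <= j)%N ->
  [/\ enorm (y j - xs) < rho, r j.+1 `^ theta <= K * enorm (y j.+1 - y j)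
    & enorm (y j.+1 - xs) <= enorm (y j.+1 - y j)
                             + E * r j.+1 `^ (1 - theta)].
Proof.
have [J [rJ yJ yVJ]] := ball_invariant_start; exists J.
have trap j : (J <= j)%N ->
    enorm (y j - xs) < rho /\ enorm (y j.+1 - xs) + V j < rho.
  elim: j => [|j IH].
    by rewrite leqn0 => /eqP J0; move: yJ yVJ; rewrite J0.
  rewrite leq_eqVlt => /predU1P[<-//|]; rewrite ltnS => Jj.
  have [yj yVj] := IH Jj; apply: ball_invariant_step => //.
  exact: le_lt_trans (decrease_noninc (leqW Jj)) rJ.
have kl j : (J <= j)%N -> r j.+1 `^ theta <= K * d j.
  move=> Jj; have [yj _] := trap j Jj; have [yj1 _] := trap j.+1 (leqW Jj).
  by apply: r_KL => //; exact: le_lt_trans (decrease_noninc (leqW Jj)) rJ.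
move=> j Jj; split; [by have [] := trap j Jj|exact: kl|].
(* Telescoping: the potential bounds the distance to every later iterate, some
of which are arbitrarily close to [xs]. *)
have tail m : enorm (y (j + m).+1 - y j.+1) + V (j + m) <= V j.
  elim: m => [|m IH]; first by rewrite addn0 subrr enorm0 add0r.
  rewrite addnS; apply: le_trans IH.
  have := potential_step (kl (j + m)%N (leq_trans Jj (leq_addr _ _))).
  have := enorm_triangle (y (j + m).+1) (y (j + m).+2) (y j.+1).
  rewrite -/(d (j + m).+1); lra.
rewrite -/(d j) -/(V j); apply/ler_addgt0Pr => e e0.
have [m jm ym] := y_acc j.+1 e0.
have := tail (m - j.+1)%N; rewrite -addSn subnKC// => tm.
have := enorm_triangle (y m) (y j.+1) xs; rewrite enorm_distC.
have := potential_ge0 (j + (m - j.+1)).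
rewrite enorm_distC [enorm (y j.+1 - y m)]enorm_distC; lra.
Qed.

End FiniteLength.

(** * Convergence rates from the recursion on the values *)

Section ConvergenceRates.
Context {R : realType} {n : nat}.

Lemma ge_powR_le1 (p q r : R) : 0 <= r <= 1 -> 0 < q -> q <= p ->
  r `^ p <= r `^ q.
Proof.
move=> /andP[r0 r1] q0 qp; have [->|rn0] := eqVneq r 0.
  by rewrite !powR0 ?gt_eqF// (lt_le_trans q0).
by apply: ger_powR => //; rewrite lt0r rn0 r0.
Qed.

Lemma powRN_le2 (p : R) (j k : nat) : 0 <= p -> (0 < k)%N -> (k <= j.*2)%N ->
  j%:R `^ (- p) <= 2 `^ p * k%:R `^ (- p).
Proof.
move=> p0 k0 kj; have j0 : (0 < j)%N by rewrite -double_gt0 (leq_trans k0).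
rewrite !powRN ler_pdivlMr ?powR_gt0 ?ltr0n// mulrC ler_pdivrMr ?powR_gt0 ?ltr0n//.
rewrite -powRM ?ler0n// le_powR// -natrM ler_nat mul2n//.
Qed.

(** A nonnegative sequence with [r j.+1 `^ (1 + nu) <= C * (r j - r j.+1)] decays
like [m `^ (- nu^-1)]: for [M] large, [M * m `^ (- nu^-1)] satisfies the reverse
recursive inequality and dominates the sequence by induction. *)
Lemma sublinear_decay (r : nat -> R) (C nu : R) (J : nat) :
  0 < C -> 0 < nu <= 1 -> (forall j, 0 <= r j) ->
  (forall j, (J <= j)%N -> r j.+1 `^ (1 + nu) <= C * (r j - r j.+1)) ->
  exists2 M : R, 0 < M &
    forall m, (0 < m)%N -> r (J + m)%N <= M * m%:R `^ (- nu^-1).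
Proof.
move=> C0 /andP[nu0 nu1] r0 rC; set q := nu^-1.
have q1 : 1 <= q by rewrite invf_ge1.
have q0 : 0 < q := lt_le_trans ltr01 q1.
pose D : R := 2 `^ q - 1.
have D0 : 0 < D.
  by rewrite subr_gt0; apply: lt_le_trans (le1r_powR _ _) => //; rewrite ?ltr1n ?ler1n.
have CD0 : 0 < 2 * C * D by rewrite !mulr_gt0.
pose M := Num.max (r J.+1) ((2 * C * D) `^ q).
have M0 : 0 < M by rewrite lt_max powR_gt0// orbT.
have Mnu : 2 * C * D <= M `^ nu.
  apply: (@le_trans _ _ (((2 * C * D) `^ q) `^ nu)).
    by rewrite -powRrM mulVf ?gt_eqF// powRr1// ltW.
  by apply: le_powR; rewrite ?powR_ge0 ?(ltW nu0)// le_max lexx orbT.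
exists M => //; elim=> [//|[|m] IH] _.
  by rewrite addn1 powR1 mulr1 le_max lexx.
have {}IH := IH isT; rewrite addnS leNgt; apply/negP.
set m1 : R := m.+1%:R in IH *; set t := M * _ => tr.
have m10 : 0 < m1 by rewrite ltr0n.
have m2E : m.+2%:R = m1 * (1 + m1^-1) :> R.
  by rewrite mulrDr mulr1 mulfV ?gt_eqF// natr1.
have m20 : 0 < m.+2%:R :> R by rewrite ltr0n.
have t0 : 0 < t by rewrite mulr_gt0 ?powR_gt0.
have tnu : t `^ nu = M `^ nu / m.+2%:R.
  rewrite powRM ?powR_ge0 ?(ltW M0)// -powRrM mulNr mulVf ?gt_eqF//.
  by rewrite powR_inv1 // ltW.
have chord : (1 + m1^-1) `^ q <= 1 + D / m1.
  apply: powR_chord => //; rewrite invr_ge0 (ltW m10)/= invf_le1//.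
  by rewrite ler1n.
(* The comparison sequence satisfies the reverse recursion, so that [r] cannot
pass from below [M * m1 `^ (- q)] to above [t]. *)
have tbound : M * m1 `^ (- q) <= t + t `^ (1 + nu) / C.
  have -> : M * m1 `^ (- q) = t * (1 + m1^-1) `^ q.
    rewrite /t m2E powRM ?addr_ge0 ?invr_ge0 ?(ltW m10)// -!mulrA -powRD.
      by rewrite addNr powRr0 mulr1.
    by rewrite addNr eqxx implyTb gt_eqF// addr_gt0 ?invr_gt0.
  rewrite powRD ?(gt_eqF t0) ?implybT// powRr1 ?(ltW t0)// tnu.
  rewrite [leRHS](_ : _ = t * (1 + M `^ nu / m.+2%:R / C)); last by ring.
  rewrite ler_pM2l//.
  apply: le_trans chord _; rewrite lerD2l.
  apply: (@le_trans _ _ (2 * C * D / m.+2%:R / C)); last first.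
    by rewrite !ler_pM2r ?invr_gt0.
  rewrite ler_pdivrMr//.
  have -> : 2 * C * D / m.+2%:R / C * m1 = D * (2 * m1 / m.+2%:R).
    by field; rewrite !gt_eqF.
  by rewrite ler_peMr ?(ltW D0)// ler_pdivlMr// mul1r -natrM ler_nat mul2n
    -addnn addSnnS leq_addl.
have := rC (J + m.+1)%N (leq_addr _ _); rewrite leNgt => /negP; apply.
have lt : t `^ (1 + nu) < r (J + m.+1).+1 `^ (1 + nu).
  by apply: gt0_ltr_powR; rewrite ?nnegrE ?(ltW t0) ?addr_gt0.
apply: le_lt_trans lt.
have : r (J + m.+1)%N - r (J + m.+1).+1 <= t `^ (1 + nu) / C by lra.
by rewrite ler_pdivlMr// mulrC.
Qed.

Context (u : nat -> R) (l : R) (y : nat -> 'rV[R]_n) (xs : 'rV[R]_n).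
Context (a C E theta : R) (J : nat).
Hypotheses (a0 : 0 < a) (C0 : 0 < C) (E0 : 0 <= E) (theta01 : 0 < theta < 1).
Hypothesis ul : forall j, l <= u j.
Hypothesis u_noninc : forall i j, (i <= j)%N -> u j <= u i.
Hypothesis u_small : forall e : R, 0 < e -> exists j, u j - l < e.
Hypothesis u_rec : forall j, (J <= j)%N ->
  (u j.+1 - l) `^ (2 * theta) <= C * (u j - u j.+1).
Hypothesis y_bound : forall j, (J <= j)%N ->
  enorm (y j.+1 - xs) <= a * (u j - l) `^ 2^-1 + E * (u j - l) `^ (1 - theta).

(** The gap between the values and their limit. *)
Let r j := u j - l.

Lemma gap_ge0 j : 0 <= r j. Proof. by rewrite subr_ge0. Qed.

Lemma gap_rec_drop j : (J <= j)%N -> r j.+1 `^ (2 * theta) <= C * r j.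
Proof.
move=> /u_rec/le_trans; apply; rewrite ler_pM2l// lerD2l lerN2; exact: ul.
Qed.

Lemma near_gap_small (e : R) : 0 < e -> \forall j \near \oo, r j < e.
Proof.
move=> /u_small[N uN]; exists N => // j /= Nj.
by apply: le_lt_trans uN; rewrite lerD2r u_noninc.
Qed.

Lemma near_pred_gap_small (e : R) : 0 < e -> \forall j \near \oo, r j.-1 < e.
Proof.
move=> /u_small[N uN]; exists N.+1 => // -[//|j] /= Nj.
by apply: le_lt_trans uN; rewrite lerD2r u_noninc.
Qed.

Lemma values_cvg : u i @[i --> \oo] --> l.
Proof.
apply/cvgrPdist_lt => e /near_gap_small; apply: filterS => j.
by rewrite distrC ger0_norm ?gap_ge0.
Qed.

(** For [theta <= 1/2] the term with exponent [1 - theta] is dominated by the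
square root of the gap, once the gap is at most one. *)
Lemma near_dist_le_sqrt_gap : theta <= 2^-1 ->
  \forall j \near \oo, enorm (y j - xs) <= (a + E) * r j.-1 `^ 2^-1.
Proof.
move=> t2; near=> j.
have -> : j = j.-1.+1 by rewrite prednK//; near: j; exists 1%N.
apply: le_trans (y_bound _) _.
  by near: j; exists J.+1 => // -[//|].
rewrite /= mulrDl lerD2l ler_wpM2l// ge_powR_le1//; last by lra.
rewrite gap_ge0/= ltW//.
by near: j; exact: near_pred_gap_small.
Unshelve. all: by end_near. Qed.

Lemma sqrt_gap_cvg D : 0 < D -> D * r i.-1 `^ 2^-1 @[i --> \oo] --> 0.
Proof.
move=> D0; apply/cvgrPdist_lt => e e0.
have := near_pred_gap_small (_ : 0 < (e / D) ^+ 2).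
rewrite exprn_gt0 ?divr_gt0// => /(_ isT); apply: filterS => j rj.
rewrite sub0r normrN ger0_norm ?mulr_ge0 ?powR_ge0 ?(ltW D0)//.
rewrite mulrC -ltr_pdivlMr//.
have -> : e / D = ((e / D) ^+ 2) `^ 2^-1.
  by rewrite powR12_sqrt ?sqr_ge0// sqrtr_sqr gtr0_norm// divr_gt0.
by apply: gt0_ltr_powR; rewrite ?nnegrE ?gap_ge0 ?sqr_ge0 ?invr_gt0.
Qed.

Lemma gap_superlinear_step j : (J <= j)%N ->
  r j.+1 <= C `^ (2 * theta)^-1 * r j `^ (2 * theta)^-1.
Proof.
case/andP: theta01 => t0 t1; have t20 : 0 < 2 * theta by rewrite mulr_gt0.
move=> /gap_rec_drop h; rewrite -powRM ?gap_ge0 ?(ltW C0)//.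
have -> : r j.+1 = (r j.+1 `^ (2 * theta)) `^ (2 * theta)^-1.
  by rewrite -powRrM mulfV ?gt_eqF// powRr1 ?gap_ge0.
by apply: le_powR h; rewrite ?powR_ge0// invr_ge0 ltW.
Qed.

(** The R-rate is witnessed by the square root of the preceding gap, which
inherits the Q-rate of the gap. *)
Lemma superlinear_rate : theta < 2^-1 ->
  Q_superlinear (2 * theta)^-1 u l /\ R_superlinear (2 * theta)^-1 y xs.
Proof.
move=> t2; set p := (2 * theta)^-1; split.
  split; first exact: values_cvg.
  exists (C `^ p); split; first exact: powR_gt0.
  near=> j; rewrite !ger0_norm ?subr_ge0//; apply: gap_superlinear_step.
  by near: j; exists J.
have D0 : 0 < a + E by rewrite ltr_wpDr.
set D := a + E in D0; exists (fun j => D * r j.-1 `^ 2^-1); split.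
- by move=> k; rewrite mulr_ge0 ?powR_ge0 ?(ltW D0).
- split; first exact: sqrt_gap_cvg.
  exists (D * (C `^ p) `^ 2^-1 / D `^ p); split.
    by rewrite divr_gt0 ?mulr_gt0 ?powR_gt0// ?powR_gt0.
  near=> j; rewrite !subr0 !ger0_norm ?mulr_ge0 ?powR_ge0 ?(ltW D0)//=.
  rewrite powRM ?powR_ge0 ?(ltW D0)// mulrA divfK ?gt_eqF ?powR_gt0//.
  rewrite -mulrA ler_pM2l// (powRAC (r j.-1)) -powRM ?powR_ge0// le_powR ?gap_ge0 ?invr_ge0//.
  have -> : r j = r j.-1.+1 by rewrite prednK//; near: j; exists 1%N.
  by apply: gap_superlinear_step; near: j; exists J.+1 => // -[//|].
- by apply: near_dist_le_sqrt_gap; exact: ltW.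
Unshelve. all: by end_near. Qed.

Lemma linear_rate : theta = 2^-1 -> Q_linear u l /\ R_linear y xs.
Proof.
move=> t2; pose q := C / (1 + C).
have q01 : 0 < q < 1.
  by rewrite divr_gt0 ?addr_gt0//= ltr_pdivrMr ?addr_gt0// mul1r ltrDr.
have step j : (J <= j)%N -> r j.+1 <= q * r j.
  move=> /u_rec; rewrite t2 mulfV// powRr1 ?gap_ge0// => h.
  rewrite /q mulrAC ler_pdivlMr ?addr_gt0//.
  by move: h; rewrite /r; lra.
split.
  split; first exact: values_cvg.
  exists q; split => //.
  near=> j; rewrite !ger0_norm ?subr_ge0//; apply: step.
  by near: j; exists J.
have D0 : 0 < a + E by rewrite ltr_wpDr.
set D := a + E in D0; exists (fun j => D * r j.-1 `^ 2^-1); split.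
- by move=> k; rewrite mulr_ge0 ?powR_ge0 ?(ltW D0).
- split; first exact: sqrt_gap_cvg.
  case/andP: q01 => q0 q1; exists (q `^ 2^-1); split.
    rewrite powR_gt0//= [ltRHS](_ : 1 = 1 `^ 2^-1); last by rewrite powR1.
    by apply: gt0_ltr_powR; rewrite ?nnegrE ?(ltW q0).
  near=> j; rewrite !subr0 !ger0_norm ?mulr_ge0 ?powR_ge0 ?(ltW D0)//=.
  rewrite mulrCA ler_pM2l// -powRM ?gap_ge0 ?(ltW q0)//.
  apply: le_powR; rewrite ?gap_ge0 ?invr_ge0//.
  have -> : r j = r j.-1.+1 by rewrite prednK//; near: j; exists 1%N.
  by apply: step; near: j; exists J.+1 => // -[//|].
- by apply: near_dist_le_sqrt_gap; rewrite t2.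
Unshelve. all: by end_near. Qed.

Lemma sublinear_rate : 2^-1 < theta -> exists C1 C2 : R, [/\ 0 < C1, 0 < C2 &
  \forall k \near \oo,
    u k - l <= C1 * k%:R `^ (- (2 * theta - 1)^-1) /\
    enorm (y k - xs) <= C2 * k%:R `^ (- ((1 - theta) / (2 * theta - 1)))].
Proof.
move=> t2; case/andP: theta01 => t0 t1; set nu := 2 * theta - 1.
have nu0 : 0 < nu by rewrite /nu; lra.
have nu1 : nu <= 1 by rewrite /nu; lra.
have u0 : 0 < 1 - theta by rewrite subr_gt0.
have rec j : (J <= j)%N -> r j.+1 `^ (1 + nu) <= C * (r j - r j.+1).
  have -> : 1 + nu = 2 * theta by rewrite /nu; ring.
  by move=> /u_rec; rewrite /r opprB addrA subrK.
have [|M M0 hM] := sublinear_decay C0 _ gap_ge0 rec; first by rewrite nu0.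
have q0 : 0 <= nu^-1 by rewrite invr_ge0 ltW.
pose C1 := M * 2 `^ nu^-1.
have C10 : 0 < C1 by rewrite mulr_gt0// powR_gt0.
have rk k : (J.*2 < k)%N -> r k <= C1 * k%:R `^ (- nu^-1).
  move=> Jk; have [Jk1 kk k2] : [/\ k = J + (k - J), 0 < k - J & k <= (k - J).*2]%N.
    by clear -Jk; split; lia.
  rewrite [in leLHS]Jk1; apply: le_trans (hM _ kk) _.
  by rewrite -mulrA ler_pM2l// powRN_le2//; exact: leq_trans kk (leq_subr _ _).
pose D := a + E; have D0 : 0 < D by rewrite ltr_wpDr.
pose s := (1 - theta) / nu; have s0 : 0 <= s by rewrite divr_ge0 ?ltW.
exists C1, (D * (C1 `^ (1 - theta) * 2 `^ s)); split => //.
  by rewrite !mulr_gt0 ?powR_gt0.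
near=> k; split.
  by apply: rk; near: k; exists J.*2.+1.
have kp : k = k.-1.+1 by rewrite prednK//; near: k; exists 1%N.
have kJ : (J.*2.+2 < k)%N by near: k; exists J.*2.+3.
have [k1 k2 k3 k4] : [/\ J <= k.-1, J.*2 < k.-1, 0 < k & k <= k.-1.*2]%N.
  by clear -kJ; split; lia.
rewrite [in leLHS]kp; apply: le_trans (y_bound k1) _.
rewrite -/(r _).
have r1 : 0 <= r k.-1 <= 1.
  by rewrite gap_ge0/= ltW//; near: k; exact: near_pred_gap_small.
apply: (@le_trans _ _ (D * r k.-1 `^ (1 - theta))).
  rewrite mulrDl lerD2r ler_pM2l// ge_powR_le1//; lra.
rewrite -!mulrA ler_pM2l//.
apply: (@le_trans _ _ ((C1 * k.-1%:R `^ (- nu^-1)) `^ (1 - theta))).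
  by apply: le_powR; rewrite ?gap_ge0 ?(ltW u0)//; exact: rk.
rewrite powRM ?powR_ge0 ?(ltW C10)// ler_pM2l ?powR_gt0// -powRrM.
have -> : - nu^-1 * (1 - theta) = - s by rewrite /s; ring.
exact: powRN_le2.
Unshelve. all: by end_near. Qed.

End ConvergenceRates.

Section DescentRates.
Context {R : realType} {n : nat}.
Context (y : nat -> 'rV[R]_n) (u : nat -> R) (l : R) (xs : 'rV[R]_n).
Context (a K theta rho eta : R).
Hypotheses (a0 : 0 < a) (K0 : 0 < K) (theta01 : 0 < theta < 1).
Hypotheses (rho0 : 0 < rho) (eta0 : 0 < eta).
Hypothesis ul : forall j, l <= u j.
Hypothesis u_decrease : forall j,
  a * enorm (y j.+1 - y j) ^+ 2 <= u j - u j.+1.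
Hypothesis u_KL : forall j,
  enorm (y j - xs) < rho -> enorm (y j.+1 - xs) < rho -> u j.+1 - l < eta ->
  (u j.+1 - l) `^ theta <= K * enorm (y j.+1 - y j).
Hypothesis y_acc : forall (e : R) N, 0 < e ->
  exists2 j, (N <= j)%N & enorm (y j - xs) < e.
Hypothesis u_small : forall e : R, 0 < e -> exists j, u j - l < e.

(** A sequence with sufficient decrease, whose gaps near the accumulation point
[xs] are bounded by the steps as in the Kurdyka-Lojasiewicz inequality, converges
with the rates determined by [theta]. *)
Theorem descent_KL_rates :
  [/\ exists J, forall j, (J <= j)%N -> enorm (y j - xs) < rho,
      theta < 2^-1 ->
        Q_superlinear (2 * theta)^-1 u l /\ R_superlinear (2 * theta)^-1 y xs,
      theta = 2^-1 -> Q_linear u l /\ R_linear y xs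
    & 2^-1 < theta -> exists C1 C2 : R, [/\ 0 < C1, 0 < C2 &
        \forall k \near \oo,
          u k - l <= C1 * k%:R `^ (- (2 * theta - 1)^-1) /\
          enorm (y k - xs) <= C2 * k%:R `^ (- ((1 - theta) / (2 * theta - 1)))]].
Proof.
case/andP: (theta01) => t0 t1.
have r0 j : 0 <= u j - l by rewrite subr_ge0.
have rdec j : a * enorm (y j.+1 - y j) ^+ 2 <= (u j - l) - (u j.+1 - l).
  by rewrite opprB addrA subrK.
have u_noninc i j : (i <= j)%N -> u j <= u i.
  by move=> /(decrease_noninc a0 rdec); rewrite lerD2r.
have [J HJ] := finite_length a0 K0 theta01 rho0 eta0 r0 rdec u_KL y_acc u_small.
pose E := K / (a * (1 - theta)).
have E0 : 0 <= E by rewrite divr_ge0 ?mulr_ge0 ?subr_ge0 ?ltW.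
have C0 : 0 < K ^+ 2 / a by rewrite divr_gt0 ?exprn_gt0.
have A0 : 0 < a^-1 `^ 2^-1 by rewrite powR_gt0 ?invr_gt0.
have u_rec j : (J <= j)%N ->
    (u j.+1 - l) `^ (2 * theta) <= K ^+ 2 / a * (u j - u j.+1).
  move=> /HJ[_ kl _]; rewrite mulrC powRrM powR_mulrn ?powR_ge0//.
  apply: (@le_trans _ _ ((K * enorm (y j.+1 - y j)) ^+ 2)).
    by rewrite ler_pXn2r ?nnegrE ?powR_ge0 ?mulr_ge0 ?enorm_ge0 ?(ltW K0).
  rewrite exprMn -mulrA ler_pM2l ?exprn_gt0// mulrC ler_pdivlMr// mulrC.
  exact: u_decrease.
have y_bound j : (J <= j)%N -> enorm (y j.+1 - xs) <=
    a^-1 `^ 2^-1 * (u j - l) `^ 2^-1 + E * (u j - l) `^ (1 - theta).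
  move=> /HJ[_ _ h]; apply: le_trans h _; apply: lerD; last first.
    apply: ler_wpM2l => //; apply: le_powR; rewrite ?subr_ge0 ?(ltW t1)//.
    by rewrite lerD2r u_noninc.
  rewrite -powRM ?invr_ge0 ?(ltW a0)// powR12_sqrt ?mulr_ge0 ?invr_ge0 ?(ltW a0)//.
  rewrite -[leLHS]ger0_norm ?enorm_ge0// -sqrtr_sqr ler_wsqrtr//.
  rewrite mulrC ler_pdivlMr// mulrC; apply: le_trans (u_decrease j) _.
  by rewrite lerD2l lerN2.
split; first by exists J => j /HJ[].
- exact: superlinear_rate A0 C0 E0 theta01 ul u_noninc u_small u_rec y_bound.
- exact: linear_rate A0 C0 E0 ul u_noninc u_small u_rec y_bound.
- exact: sublinear_rate A0 C0 E0 theta01 ul u_noninc u_small u_rec y_bound.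
Qed.

End DescentRates.

(** * The regularized model at one iteration *)

Section RegularizedModel.
Context {R : realType} {n : nat}.
Context (f : 'rV[R]_n -> R) (phi : 'rV[R]_n -> \bar R).
Hypothesis phi_neqNy : forall y, phi y != -oo%E.
Implicit Types (x y z w : 'rV[R]_n) (B : 'M[R]_n) (mu : R).

(** The real values of [phi] and of the objective; they are meaningful on the
effective domain of [phi]. *)
Let phir y : R := fine (phi y).
Let Fr y : R := fine (objective f phi y).

(** The smooth part of the regularized model around [x]. *)
Definition smooth_model x B mu y : R :=
  f x + dotp (grad f x) (y - x) + 2^-1 * quadform B (y - x)
  + mu / 2 * enorm (y - x) ^+ 2.

Lemma edom_fineK y : edom phi y -> phi y = (phir y)%:E.
Proof. by move=> dy; rewrite /phir fineK// fin_numE phi_neqNy lt_eqF. Qed.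

Lemma objective_edom y : edom phi y -> objective f phi y = (f y + phir y)%:E.
Proof. by move=> dy; rewrite /objective edom_fineK. Qed.

Lemma fine_objective y : edom phi y -> Fr y = f y + phir y.
Proof. by move=> dy; rewrite /Fr objective_edom. Qed.

Lemma edom_objective y : objective f phi y \is a fin_num <-> edom phi y.
Proof.
split; last by move=> dy; rewrite objective_edom.
by rewrite /objective fin_numD => /andP[_]; rewrite fin_numElt => /andP[].
Qed.

(** The regularized model is the sum of [phi] and a quadratic function. *)
Lemma qhatE x B mu y :
  qhat f phi x B mu y = (phi y + (smooth_model x B mu y)%:E)%E.
Proof. by rewrite /qhat /qmodel addeAC addeC -EFinD. Qed.

Lemma smooth_model_center x B mu : smooth_model x B mu x = f x.
Proof.
by rewrite /smooth_model subrr dotp0r /quadform dotp0r enorm0 expr0n/= !mulr0 !addr0.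
Qed.

Lemma smooth_modelD x B mu z h : B^T = B ->
  smooth_model x B mu (z + h) = smooth_model x B mu z
    + (dotp (grad f x) h + dotp ((z - x) *m B) h + mu * dotp (z - x) h)
    + (2^-1 * quadform B h + mu / 2 * enorm h ^+ 2).
Proof.
move=> Bs; rewrite /smooth_model (addrAC z).
move: (z - x) (grad f x) => d g.
rewrite quadformD// dotpDr.
have -> : enorm (d + h) ^+ 2 = enorm d ^+ 2 + 2 * dotp d h + enorm h ^+ 2.
  by rewrite !sqr_enorm dotpDl 2!dotpDr (dotpC h d); ring.
by field.
Qed.

Lemma continuous_smooth_model x B mu : continuous (smooth_model x B mu).
Proof.
have cB i := @continuous_coordB R n x i.
move=> y; rewrite /smooth_model.
have c1 : {for y, continuous (fun y => dotp (grad f x) (y - x))}.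
  by apply: continuous_dotp => i; [exact: cst_continuous|exact: cB].
have c2 : {for y, continuous (fun y => quadform B (y - x))}.
  apply: continuous_dotp => i; last exact: cB.
  by apply: continuous_coord_mulmx => j; exact: cB.
have c3 : {for y, continuous (fun y => enorm (y - x) ^+ 2)}.
  rewrite (_ : (fun _ => _) = fun y => dotp (y - x) (y - x)); last first.
    by apply/funext => w; rewrite sqr_enorm.
  by apply: continuous_dotp => i; exact: cB.
apply: (@continuousD _ _ _ (fun y => f x + dotp (grad f x) (y - x)
   + 2^-1 * quadform B (y - x))).
  apply: (@continuousD _ _ _ (fun y => f x + dotp (grad f x) (y - x))).
    by apply: (@continuousD _ _ _ (fun=> f x)) c1; exact: cst_continuous.
  by apply: (@continuousM _ _ (fun=> 2^-1)) c2; exact: cst_continuous.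
by apply: (@continuousM _ _ (fun=> mu / 2)) c3; exact: cst_continuous.
Qed.

(** A lower semicontinuous model with a bounded sublevel set has a minimizer. *)
Lemma minimizer_exists x B mu (e : R) : lower_semicontinuous phi ->
  (forall y, (qhat f phi x B mu y <= qhat f phi x B mu x)%E ->
     enorm (y - x) <= e) ->
  exists z, global_minimizer (qhat f phi x B mu) z.
Proof.
move=> lphi bnd.
have e0 : 0 <= e by have := bnd x (lexx _); rewrite subrr enorm0.
have xx : eball x e x by rewrite /eball/= subrr enorm0.
have lq : lower_semicontinuous (qhat f phi x B mu).
  rewrite (_ : qhat _ _ _ _ _ = fun y => phi y + (smooth_model x B mu y)%:E)%E.
    exact: lsc_add_continuous (@continuous_smooth_model x B mu).
  by apply/funext => y; rewrite qhatE.
have qN y : qhat f phi x B mu y != -oo%E.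
  by rewrite qhatE; case: (phi y) (phi_neqNy y).
have [z zx zmin] := lsc_attains_min (@compact_eball R n x e)
  (ex_intro _ x xx) lq qN.
exists z => y; have [yx|yx] := leP (qhat f phi x B mu y) (qhat f phi x B mu x).
  exact/zmin/bnd.
exact: le_trans (zmin x xx) (ltW yx).
Qed.

Section OneMinimizer.
Context (x z : 'rV[R]_n) (B : 'M[R]_n) (mu : R).
Hypothesis dx : edom phi x.
Hypothesis zmin : global_minimizer (qhat f phi x B mu) z.

Lemma minimizer_edom : edom phi z.
Proof.
have := zmin x; rewrite !qhatE (edom_fineK dx) -EFinD /edom/=.
by case: (phi z) => // r _; rewrite ltry.
Qed.

(** Minimality, between finite values. *)
Lemma minimizer_le y : edom phi y ->
  phir z + smooth_model x B mu z <= phir y + smooth_model x B mu y.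
Proof.
move=> dy; have := zmin y.
by rewrite !qhatE (edom_fineK dy) (edom_fineK minimizer_edom) -!EFinD lee_fin.
Qed.

(** The ratio test in terms of real values. *)
Lemma ratio_testE (c1 : R) :
  (c1%:E * predred f phi x B z <= ared f phi x z)%E =
  (c1 * (Fr x - (smooth_model x B mu z - mu / 2 * enorm (z - x) ^+ 2 + phir z))
   <= Fr x - Fr z).
Proof.
have dz := minimizer_edom.
rewrite /predred /ared /qmodel (fine_objective dx) (fine_objective dz).
rewrite (objective_edom dx) (objective_edom dz) (edom_fineK dz).
by rewrite -!EFinD -EFinM lee_fin /smooth_model addrK.
Qed.

(** The predicted reduction is at least the regularization term. *)
Lemma predred_ge : mu / 2 * enorm (z - x) ^+ 2 <=
  Fr x - (smooth_model x B mu z - mu / 2 * enorm (z - x) ^+ 2 + phir z).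
Proof.
have := minimizer_le dx; rewrite smooth_model_center fine_objective//; lra.
Qed.

(** The difference between the predicted and the actual reduction is at most
[(L + MB / 2)] times the squared step, which for large [mu] is at most the fraction
[1 - c1] of the predicted reduction. *)
Lemma ratio_test_large_mu (c1 MB L e : R) (x0 : 'rV[R]_n) :
  0 < c1 < 1 -> opnorm B <= MB ->
  (forall y, eball x0 e y -> differentiable f y) ->
  (forall y w, eball x0 e y -> eball x0 e w ->
     enorm (grad f y - grad f w) <= L * enorm (y - w)) ->
  0 <= L -> eball x0 e x -> eball x0 e z ->
  L + MB / 2 <= (1 - c1) * (mu / 2) ->
  (c1%:E * predred f phi x B z <= ared f phi x z)%E.
Proof.
move=> /andP[c10 c11] BM df lipf L0 xe ze hmu.
have dz := minimizer_edom.
rewrite ratio_testE; set p := Fr x - _.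
have pge : mu / 2 * enorm (z - x) ^+ 2 <= p := predred_ge.
have := descent df lipf L0 xe ze; rewrite ler_norml => /andP[_ des].
have := norm_quadform_le (z - x) BM; rewrite ler_norml => /andP[qd _].
have pE : Fr x - Fr z = p + (smooth_model x B mu z
    - mu / 2 * enorm (z - x) ^+ 2 - f z).
  by rewrite /p (fine_objective dz); ring.
rewrite pE /smooth_model.
have s0 : 0 <= enorm (z - x) ^+ 2 by exact: sqr_ge0.
have : (1 - c1) * (mu / 2 * enorm (z - x) ^+ 2) <= (1 - c1) * p.
  by rewrite ler_pM2l// subr_gt0.
have := ler_wpM2r s0 hmu.
lra.
Qed.

(** A successful step decreases the objective sufficiently. *)
Lemma ratio_test_decrease (c1 : R) : 0 < c1 ->
  (c1%:E * predred f phi x B z <= ared f phi x z)%E ->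
  c1 * (mu / 2) * enorm (z - x) ^+ 2 <= Fr x - Fr z.
Proof.
move=> c10; rewrite ratio_testE; apply: le_trans.
by rewrite -mulrA ler_pM2l//; exact: predred_ge.
Qed.

(** The arithmetic of the next proof: optimality of [z] against [y], the bounds
on the quadratic terms, and the first-order expansion of [f] at [z]. *)
Lemma subdiff_arith (mu' py pz s t q h2 fy fz tg b c m : R) :
  pz + s <= py + (s + t + (2^-1 * q + mu' / 2 * h2)) -> q <= c * h2 ->
  mu' * h2 <= m * h2 -> ((c + m) / 2 + 1) * h2 <= b -> 0 <= h2 ->
  - b <= fy - fz - tg -> - (2 * b) <= fy + py - (fz + pz) - (tg - t).
Proof. lra. Qed.

(** Fermat's rule for the model, transported to the objective. *)
Lemma minimizer_regular_subdiff : B^T = B -> differentiable f z ->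
  regular_subdiff (objective f phi) z
    (grad f z - grad f x - (z - x) *m B - mu *: (z - x)).
Proof.
move=> Bs df; have dz := minimizer_edom.
set v := _ - mu *: _; split; first exact/edom_objective.
rewrite limf_einfE; apply/lee_subgt0Pr => e e0; rewrite sub0e.
pose K := (`|opnorm B| + `|mu|) / 2 + 1.
have K0 : 0 < K by rewrite ltr_wpDl// divr_ge0// addr_ge0.
have e2 : 0 < e / 2 by rewrite divr_gt0.
have dl : \forall y \near z, - (e / 2) * enorm (y - z)
    <= f y - f z - dotp (grad f z) (y - z) by exact: diff_lower.
have eK : nbhs z (eball z (e / 2 / K)) by apply: nbhs_eball; rewrite divr_gt0.
(* On [V] the expansion error of [f] and the quadratic terms are each at most
[e / 2] times the distance to [z]. *)
pose V : set 'rV[R]_n := [set y | y != z] `&` ([set y | - (e / 2) * enorm (y - z)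
    <= f y - f z - dotp (grad f z) (y - z)] `&` eball z (e / 2 / K)).
apply: le_trans (ereal_sup_ubound _); last first.
  exists V; last reflexivity.
  have : nbhs z ([set y | - (e / 2) * enorm (y - z)
    <= f y - f z - dotp (grad f z) (y - z)] `&` eball z (e / 2 / K)).
    exact: filterI.
  by rewrite /dnbhs /within/=; apply: filterS => y hy yz; split.
apply: le_ereal_inf_tmp => _ [y [/= yz [yl ye]] <-].
have yz0 : 0 < enorm (y - z).
  rewrite lt0r enorm_ge0 andbT; apply: contra yz => /eqP/enorm_eq0/eqP.
  by rewrite subr_eq0.
have [phiy|dy] := eqVneq (phi y) +oo%E.
  rewrite (objective_edom dz) /objective phiy /= .
  by rewrite mulyr gtr0_sg ?invr_gt0// mul1e leey.
have {}dy : edom phi y by rewrite /edom/= ltey.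
rewrite (objective_edom dz) (objective_edom dy) -!EFinB -EFinM lee_fin.
rewrite ler_pdivlMr//.
have := minimizer_le dy.
have -> : smooth_model x B mu y = smooth_model x B mu (z + (y - z)).
  by rewrite addrC subrK.
rewrite smooth_modelD//.
have vh : dotp v (y - z) = dotp (grad f z) (y - z) - (dotp (grad f x) (y - z)
    + dotp ((z - x) *m B) (y - z) + mu * dotp (z - x) (y - z)).
  rewrite /v; move: (y - z) (z - x) => h d.
  by rewrite !dotpBl dotpZl !opprD !addrA.
rewrite vh => min_le.
have -> : - e * enorm (y - z) = - (2 * (e / 2 * enorm (y - z))) by field.
apply: (subdiff_arith (c := `|opnorm B|) (m := `|mu|)) min_le _ _ _ (sqr_ge0 _) _; last by rewrite -mulNr; exact: yl.
- have := norm_quadform_le (y - z) (ler_norm (opnorm B)).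
  by rewrite ler_norml => /andP[].
- by rewrite ler_wpM2r ?sqr_ge0// ler_norm.
- rewrite -/K expr2 mulrA ler_pM2r// mulrC.
  by move: ye; rewrite /eball/= ler_pdivlMr.
Qed.

(** A minimizer of the model has an objective value comparable with that of any
point [w], up to squared distances to the center. *)
Lemma minimizer_value_le (MB L e : R) (x0 w : 'rV[R]_n) :
  opnorm B <= MB ->
  (forall y, eball x0 e y -> differentiable f y) ->
  (forall y w, eball x0 e y -> eball x0 e w ->
     enorm (grad f y - grad f w) <= L * enorm (y - w)) ->
  0 <= L -> 0 <= mu -> eball x0 e x -> eball x0 e z -> eball x0 e w ->
  edom phi w ->
  Fr z <= Fr w + (L + MB) * enorm (z - x) ^+ 2
          + (L + MB + mu) * enorm (w - x) ^+ 2.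
Proof.
move=> BM df lipf L0 mu0 xe ze we dw; have dz := minimizer_edom.
have := minimizer_le dw; rewrite !fine_objective// /smooth_model.
have := descent df lipf L0 xe ze; rewrite ler_norml => /andP[_ des1].
have := descent df lipf L0 xe we; rewrite ler_norml => /andP[des2 _].
have := norm_quadform_le (z - x) BM; rewrite ler_norml => /andP[q1 _].
have := norm_quadform_le (w - x) BM; rewrite ler_norml => /andP[_ q2].
have s1 : 0 <= mu * enorm (z - x) ^+ 2 by rewrite mulr_ge0 ?sqr_ge0.
have s2 : 0 <= mu * enorm (w - x) ^+ 2 by rewrite mulr_ge0 ?sqr_ge0.
have s3 : 0 <= MB * enorm (z - x) ^+ 2.
  by apply: le_trans (norm_quadform_le _ BM).
have s4 : 0 <= MB * enorm (w - x) ^+ 2.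
  by apply: le_trans (norm_quadform_le _ BM).
lra.
Qed.

End OneMinimizer.

(** By prox-boundedness, the sublevel set of the model at its center shrinks to
the center when [mu] grows, uniformly in centers that remain bounded together
with the values and gradients of [f]. *)
Lemma sublevel_small (gam m G F0 Mf Rb MB e : R) (xb : 'rV[R]_n) :
  0 < gam -> 0 < e ->
  (forall y, edom phi y -> m <= phir y + (2 * gam)^-1 * enorm (y - xb) ^+ 2) ->
  exists mu1 : R, forall x B mu y, mu1 <= mu -> opnorm B <= MB -> edom phi x ->
    Fr x <= F0 -> `|f x| <= Mf -> enorm (grad f x) <= G -> enorm (x - xb) <= Rb ->
    (qhat f phi x B mu y <= qhat f phi x B mu x)%E -> enorm (y - x) <= e.
Proof.
move=> gam0 e0 prox.
(* Bounding each term of the inequality between the model values at [y] and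
[x] gives [T * enorm (y - x) ^+ 2 <= M2]. *)
pose M2 := F0 + Mf - m + Rb ^+ 2 / gam + G ^+ 2.
pose T := (`|M2| + 1) / e ^+ 2.
have e20 : 0 < e ^+ 2 by rewrite exprn_gt0.
have T0 : 0 < T by rewrite divr_gt0// ltr_wpDl.
exists (2 * (MB / 2 + gam^-1 + 1 + T)) => x B mu y hmu BM dx Fx fx gx xxb.
rewrite !qhatE (edom_fineK dx) smooth_model_center.
have [phiy|] := eqVneq (phi y) +oo%E; first by rewrite phiy.
rewrite -ltey => dy; rewrite (edom_fineK dy) -!EFinD lee_fin /smooth_model.
move: Fx; rewrite fine_objective// => Fx.
set d := y - x; move=> sub.
have g1 : - (G ^+ 2 + enorm d ^+ 2) <= dotp (grad f x) d.
  have := norm_dotp_le (grad f x) d; rewrite ler_norml => /andP[+ _].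
  have := enorm_ge0 d; have := enorm_ge0 (grad f x).
  set u := enorm (grad f x) in gx *; set v := enorm d => u0 v0 uv.
  have := ler_wpM2r v0 gx; have := sqr_ge0 (G - v); rewrite sqrrB.
  by have := sqr_ge0 G; have := sqr_ge0 v; lra.
have := norm_quadform_le d BM; rewrite ler_norml => /andP[q1 _].
have := ler_norm (- f x); rewrite normrN => fx'.
have tri : enorm (y - xb) ^+ 2 <= 2 * enorm d ^+ 2 + 2 * Rb ^+ 2.
  have := enorm_triangle x y xb; rewrite -/d => t.
  have := enorm_ge0 (y - xb); have := enorm_ge0 d; have := enorm_ge0 (x - xb).
  move: t xxb; set u := enorm (y - xb); set v := enorm d; set w := enorm (x - xb).
  move=> h1 h2 h3 h4 h5.
  have : u ^+ 2 <= (v + Rb) ^+ 2 by rewrite ler_pXn2r// ?nnegrE; lra.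
  by have := sqr_ge0 (v - Rb); nra.
have pr := prox y dy.
have gtri : (2 * gam)^-1 * enorm (y - xb) ^+ 2
    <= gam^-1 * enorm d ^+ 2 + Rb ^+ 2 / gam.
  rewrite invfM -mulrA mulrCA.
  rewrite [leRHS](_ : _ = gam^-1 * (2^-1 * (2 * enorm d ^+ 2 + 2 * Rb ^+ 2))).
    by rewrite ler_pM2l ?invr_gt0// ler_pM2l.
  by field; rewrite gt_eqF.
have s0 : 0 <= enorm d ^+ 2 by exact: sqr_ge0.
have key : T * enorm d ^+ 2 <= M2.
  have := ler_wpM2r s0 hmu; rewrite /M2.
  have -> : 2 * (MB / 2 + gam^-1 + 1 + T) * enorm d ^+ 2 =
    MB * enorm d ^+ 2 + 2 * (gam^-1 * enorm d ^+ 2) + 2 * enorm d ^+ 2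
    + 2 * (T * enorm d ^+ 2) by field; rewrite gt_eqF.
  lra.
have : enorm d ^+ 2 <= e ^+ 2.
  have := le_trans key (ler_norm M2); rewrite /T mulrAC ler_pdivrMr// => h.
  rewrite -(ler_pM2l (_ : 0 < `|M2| + 1)) ?ltr_wpDl//.
  by apply: le_trans h _; rewrite ler_wpM2r ?(ltW e20)// lerDl.
by rewrite ler_pXn2r ?nnegrE ?enorm_ge0 ?(ltW e0).
Qed.

End RegularizedModel.

(** * Runs of the algorithm *)

Section AlgorithmRun.
Context {R : realType} {n : nat}.
Context (f : 'rV[R]_n -> R) (phi : 'rV[R]_n -> \bar R).
Context (c1 sigma2 mumin mumax MB : R).
Context (x : nat -> 'rV[R]_n) (B : nat -> 'M[R]_n) (mu : nat -> R).
Context (xhat : nat -> option 'rV[R]_n).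
Hypothesis phi_neqNy : forall y, phi y != -oo%E.
Hypothesis c101 : 0 < c1 < 1.
Hypothesis sigma2_gt1 : 1 < sigma2.
Hypothesis mumin_gt0 : 0 < mumin.
Hypothesis run : algorithm_run f phi c1 sigma2 mumin mumax x B mu xhat.
Hypothesis MB_gt0 : 0 < MB.
Hypothesis B_bounded : forall k, opnorm (B k) <= MB.

Let S := successful f phi c1 x B xhat.
Let F := objective f phi.
Let Fr k : R := fine (F (x k)).
Let decrease_const := c1 * (mumin / 2).

Lemma decrease_const_gt0 : 0 < decrease_const.
Proof. by case/andP: c101 => c10 _; rewrite mulr_gt0// divr_gt0. Qed.

Lemma success_minimizer k : S k ->
  global_minimizer (qhat f phi (x k) (B k) (mu k)) (x k.+1).
Proof.
move=> [z az]; have [-> _ _] := run_success run az.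
by case: az => /(run_found run).
Qed.

Lemma success_ratio k : S k ->
  (c1%:E * predred f phi (x k) (B k) (x k.+1) <= ared f phi (x k) (x k.+1))%E.
Proof. by move=> [z az]; have [-> _ _] := run_success run az; case: az. Qed.

Lemma iterate_edom k : edom phi (x k).
Proof.
elim: k => [|k IH]; first exact: run_x0 run.
have [Sk|/(run_failure run)[-> _ _]//] := pselect (S k).
exact: minimizer_edom IH (success_minimizer Sk).
Qed.

Lemma iterate_sym k : (B k)^T = B k.
Proof.
elim: k => [|k IH]; first exact: run_B0 run.
have [[z az]|/(run_failure run)[_ -> _]//] := pselect (S k).
by have [] := run_success run az.
Qed.

Lemma mu_ge k : mumin <= mu k.
Proof.
elim: k => [|k IH]; first by have /andP[] := run_mu0 run.
have [[z az]|/(run_failure run)[_ _ ->]] := pselect (S k).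
  by have [_ _ /andP[]] := run_success run az.
by rewrite (le_trans IH)// ler_peMl ?(le_trans (ltW mumin_gt0))// ltW.
Qed.

Lemma iterate_decrease k :
  decrease_const * enorm (x k.+1 - x k) ^+ 2 <= Fr k - Fr k.+1.
Proof.
case/andP: (c101) => c10 _.
have [Sk|/(run_failure run)[xk _ _]] := pselect (S k); last first.
  by rewrite /Fr xk !subrr enorm0 expr0n/= mulr0.
apply: le_trans (ratio_test_decrease phi_neqNy (iterate_edom k)
  (success_minimizer Sk) c10 (success_ratio Sk)).
by rewrite ler_wpM2r ?sqr_ge0// ler_pM2l// ler_pM2r// mu_ge.
Qed.

Lemma value_noninc i j : (i <= j)%N -> Fr j <= Fr i.
Proof.
elim: j => [|j IH]; first by rewrite leqn0 => /eqP->.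
rewrite leq_eqVlt => /predU1P[->//|]; rewrite ltnS => /IH; apply: le_trans.
rewrite -subr_ge0; apply: le_trans (iterate_decrease j).
by rewrite mulr_ge0 ?sqr_ge0// ltW// decrease_const_gt0.
Qed.

(** Between consecutive successes the iterate does not move and the
regularization parameter grows geometrically. *)
Lemma failure_run k m : (forall i, (k <= i < k + m)%N -> ~ S i) ->
  x (k + m)%N = x k /\ mu (k + m)%N = sigma2 ^+ m * mu k.
Proof.
elim: m => [|m IH] fl; first by rewrite addn0 mul1r.
have [|IHx IHm] := IH.
  by move=> i /andP[ki im]; apply: fl; rewrite ki addnS leqW.
have /(run_failure run)[] : ~ S (k + m)%N.
  by apply: fl; rewrite leq_addr addnS leqnn.
by rewrite addnS IHx IHm => -> _ ->; rewrite exprS mulrA.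
Qed.

Lemma iterate_after_failures k k' : (k < k')%N ->
  (forall i, (k < i < k')%N -> ~ S i) -> x k' = x k.+1.
Proof.
move=> kk' fl; have [|xk _] := @failure_run k.+1 (k' - k.+1).
  by rewrite subnKC// => i /fl.
by move: xk; rewrite subnKC.
Qed.

Section NearStationaryPoint.
Context (xs : 'rV[R]_n) (e L mubar muhat : R).
Hypothesis e_gt0 : 0 < e.
Hypothesis L_ge0 : 0 <= L.
Hypothesis xs_edom : edom phi xs.
Hypothesis f_diff : forall y, eball xs e y -> differentiable f y.
Hypothesis f_lip : forall y w, eball xs e y -> eball xs e w ->
  enorm (grad f y - grad f w) <= L * enorm (y - w).
Let Fs : R := fine (F xs).

(** Near [xs], a large regularization parameter forces success: the model then
has a minimizer, which lies so close to [x k] that the descent lemma applies. *)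
Lemma large_mu_success : lower_semicontinuous phi -> prox_bounded phi ->
  exists mub : R, forall k, enorm (x k - xs) <= e / 2 -> mub <= mu k -> S k.
Proof.
move=> lphi [gam [xb [gam0 pb]]]; case/andP: (c101) => c10 c11.
have e2 : 0 < e / 2 by rewrite divr_gt0.
(* Prox-boundedness, with a real lower bound on the effective domain. *)
have [m hm] : exists m : R, forall y, edom phi y ->
    m <= fine (phi y) + (2 * gam)^-1 * enorm (y - xb) ^+ 2.
  have [r rinf] : exists r : R, (r%:E <= ereal_inf (range (fun y =>
      phi y + ((2 * gam)^-1 * enorm (y - xb) ^+ 2)%:E)))%E.
    case: ereal_inf pb => [r _| _|//]; first by exists r.
    by exists 0; rewrite leey.
  exists r => y dy; rewrite -lee_fin; apply: le_trans rinf _.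
  rewrite EFinD -(edom_fineK phi_neqNy dy).
  by apply: ereal_inf_lbound; exists y.
have xsxs : eball xs e xs by rewrite /eball/= subrr enorm0 ltW.
pose G := enorm (grad f xs) + L * e.
pose Mf := `|f xs| + enorm (grad f xs) * e + L * e ^+ 2.
have [mu1 hmu1] := sublevel_small f phi_neqNy G (Fr 0) Mf (e + enorm (xs - xb)) MB
  gam0 e2 hm.
exists (Num.max mu1 (2 * ((L + MB / 2) / (1 - c1)))) => k xk.
rewrite ge_max => /andP[k1 k2].
have xke : enorm (x k - xs) <= e by apply: le_trans xk _; rewrite ler_pdivrMr// ler_pMr// ler1n.
have L1 : L * enorm (x k - xs) <= L * e by rewrite ler_wpM2l.
have sub y : (qhat f phi (x k) (B k) (mu k) y
    <= qhat f phi (x k) (B k) (mu k) (x k))%E -> enorm (y - x k) <= e / 2.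
  apply: hmu1 => //; first exact: iterate_edom.
  - exact: value_noninc.
  - have := descent f_diff f_lip L_ge0 xsxs xke.
    have := norm_dotp_le (grad f xs) (x k - xs).
    have : L * enorm (x k - xs) ^+ 2 <= L * e ^+ 2.
      by rewrite ler_wpM2l// ler_pXn2r ?nnegrE ?enorm_ge0// ltW.
    have : enorm (grad f xs) * enorm (x k - xs) <= enorm (grad f xs) * e.
      by rewrite ler_wpM2l ?enorm_ge0.
    have := ler_normD (f (x k) - f xs - dotp (grad f xs) (x k - xs))
      (f xs + dotp (grad f xs) (x k - xs)).
    have := ler_normD (f xs) (dotp (grad f xs) (x k - xs)).
    rewrite (_ : _ - _ - _ + (_ + _) = f (x k)); last by ring.
    rewrite /Mf; lra.
  - have := enormD (grad f (x k) - grad f xs) (grad f xs).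
    rewrite subrK => h; apply: le_trans h _.
    by rewrite addrC lerD2l (le_trans (f_lip xke xsxs)).
  - by apply: le_trans (enorm_triangle xs _ _) _; rewrite lerD2r.
have [z0 z0min] := minimizer_exists phi_neqNy lphi sub.
case xh : (xhat k) => [z|]; last first.
  by exfalso; apply: (run_not_found run xh); exists z0.
have zmin := run_found run xh.
exists z; split => //.
have zxk : enorm (z - x k) <= e / 2 by exact/sub/zmin.
apply: (ratio_test_large_mu phi_neqNy (iterate_edom k) zmin c101
  (B_bounded k) f_diff f_lip L_ge0) => //.
  by have := enorm_triangle (x k) z xs; rewrite /eball/=; lra.
have c10' : 0 < 1 - c1 by rewrite subr_gt0.
move: k2; rewrite mulrA ler_pdivrMr// => k2.
lra.
Qed.

Hypothesis mubarP : forall k, enorm (x k - xs) <= e / 2 -> mubar <= mu k -> S k.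
Hypothesis muhat_max : mumax <= muhat.
Hypothesis muhat_bar : sigma2 * mubar <= muhat.

(** If the previous iteration succeeded, the parameter was reset below [mumax];
otherwise the center was the same and the previous parameter was below
[mubar]. *)
Lemma mu_le_near k : enorm (x k - xs) <= e / 2 -> mu k <= muhat.
Proof.
case: k => [_|k].
  by have /andP[_ h] := run_mu0 run; exact: le_trans muhat_max.
have [[z az] _|nS] := pselect (S k).
  by have [_ _ /andP[_ h]] := run_success run az; exact: le_trans muhat_max.
have [-> _ ->] := run_failure run nS => xk.
apply: le_trans muhat_bar; rewrite ler_pM2l ?(lt_trans ltr01)// ltW// ltNge.
by apply/negP => /(mubarP xk).
Qed.

(** After a bounded number of failures near [xs] the parameter exceeds [mubar]
and the iteration succeeds. *)
Lemma failures_bounded : exists N : nat, forall k k', (k < k')%N ->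
  (forall i, (k < i < k')%N -> ~ S i) -> enorm (x k.+1 - xs) <= e / 2 ->
  (k' - k <= N)%N.
Proof.
have [N hN] : exists N : nat, mubar <= sigma2 ^+ N * mumin.
  have s1 : 0 < sigma2 - 1 by rewrite subr_gt0.
  have [N] : exists N : nat, `|mubar| / (mumin * (sigma2 - 1)) < N%:R.
    by exists (Num.trunc (`|mubar| / (mumin * (sigma2 - 1)))).+1; exact: truncnS_gt.
  rewrite ltr_pdivrMr ?mulr_gt0// => h; exists N.
  (* Bernoulli's inequality. *)
have bern (p : nat) : 1 + p%:R * (sigma2 - 1) <= sigma2 ^+ p.
    elim: p => [|p IH]; first by rewrite mul0r addr0.
    rewrite exprS -natr1; apply: (@le_trans _ _ (sigma2 * (1 + p%:R * (sigma2 - 1)))).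
      have : 0 <= p%:R * (sigma2 - 1) ^+ 2 by rewrite mulr_ge0 ?sqr_ge0.
      lra.
    by rewrite ler_pM2l// (lt_trans ltr01).
  apply: le_trans (ler_norm _) _.
  apply: le_trans (ltW h) (le_trans _ (ler_wpM2r (ltW mumin_gt0) (bern N))).
  by rewrite mulrDl mul1r (mulrC mumin) mulrA lerDr ltW.
exists N.+1 => k k' kk' fl xk; rewrite leqNgt; apply/negP => big.
have {}big : (k.+1 + N < k')%N by move: big; rewrite ltn_subRL addnS.
have fl' i : (k.+1 <= i < k.+1 + N)%N -> ~ S i.
  by move=> /andP[ki iN]; apply: fl; rewrite ki (ltn_trans iN).
have [xN muN] := failure_run fl'.
apply: (fl (k.+1 + N)%N); first by rewrite big leq_addr.
apply: mubarP; first by rewrite xN.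
rewrite muN; apply: le_trans hN _.
by rewrite ler_pM2l ?mu_ge// exprn_gt0// (lt_trans ltr01).
Qed.

(** The subgradient produced by a successful iteration near [xs]. *)
Lemma success_subgradient k : S k ->
  enorm (x k - xs) <= e / 2 -> enorm (x k.+1 - xs) <= e / 2 ->
  exists2 v, limiting_subdiff F (x k.+1) v &
    enorm v <= (L + MB + muhat) * enorm (x k.+1 - x k).
Proof.
move=> Sk xk xk1; have eh : e / 2 <= e by rewrite ler_pdivrMr// ler_pMr// ler1n.
have dz := iterate_edom k.+1.
have sub := minimizer_regular_subdiff phi_neqNy (iterate_edom k)
  (success_minimizer Sk) (iterate_sym k) (f_diff (le_trans xk1 eh)).
set v := (_ - mu k *: _) in sub; exists v.
  split; first exact/edom_objective.
  exists (fun=> x k.+1), (fun=> v); split => //; exact: cvg_cst.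
apply: le_trans (enormB _ _) _; rewrite !mulrDl lerD//; last first.
  rewrite enormZ ger0_norm ?ler_wpM2r ?enorm_ge0 ?mu_le_near//.
  exact: le_trans (ltW mumin_gt0) (mu_ge k).
apply: le_trans (enormB _ _) _; rewrite lerD//.
  by apply: f_lip; [exact: le_trans xk1 eh|exact: le_trans xk eh].
by apply: le_trans (enorm_mulmx_le _ _) _; rewrite ler_wpM2r ?enorm_ge0.
Qed.

(** The Kurdyka-Lojasiewicz inequality at a successful iterate, solved for the
gap in the values; the case of a zero gap is trivial. *)
Lemma success_KL (c theta eta rho : R) k : 0 < c -> 0 < theta < 1 ->
  (forall y, enorm (y - xs) < rho -> (F xs < F y < F xs + eta%:E)%E ->
     (1 <= (derive1 (fun t => c * t `^ (1 - theta)) (fine (F y - F xs)))%:E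
           * dist_set 0%R (limiting_subdiff F y))%E) ->
  rho <= e / 2 -> S k -> enorm (x k - xs) < rho -> enorm (x k.+1 - xs) < rho ->
  Fs <= Fr k.+1 -> Fr k.+1 - Fs < eta ->
  (Fr k.+1 - Fs) `^ theta <=
    c * (1 - theta) * (L + MB + muhat) * enorm (x k.+1 - x k).
Proof.
move=> c0 /andP[t0 t1] KL rhoe Sk xk xk1 Fge Feta.
have [v vsub vle] := success_subgradient Sk (ltW (lt_le_trans xk rhoe))
  (ltW (lt_le_trans xk1 rhoe)).
have u0 : 0 < 1 - theta by rewrite subr_gt0.
have cu0 : 0 < c * (1 - theta) by rewrite mulr_gt0.
have vle' := ler_wpM2l (ltW cu0) vle.
rewrite -mulrA; apply: le_trans vle'.
set r := Fr k.+1 - Fs in Feta *.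
have r0 : 0 <= r by rewrite subr_ge0.
have [rz|rn0] := eqVneq r 0.
  by rewrite rz powR0 ?gt_eqF// mulr_ge0 ?enorm_ge0 ?ltW.
have rp : 0 < r by rewrite lt0r rn0.
have Fxs : F xs = Fs%:E by rewrite /Fs fineK//; exact/edom_objective.
have Fk : F (x k.+1) = (Fr k.+1)%:E.
  by rewrite /Fr fineK//; apply/edom_objective => //; exact: iterate_edom.
have := KL (x k.+1) xk1; rewrite Fxs Fk -EFinD -EFinB !lte_fin /= -/r.
have -> : Fs < Fr k.+1 < Fs + eta.
  by move: rp Feta; rewrite /r subr_gt0 ltrBlDl => -> ->.
move=> /(_ isT).
have -> : derive1 (fun t => c * t `^ (1 - theta)) r = c * ((1 - theta) * r `^ (- theta)).
  rewrite derive1E; have dp := is_derive1_powR (1 - theta) rp.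
  rewrite [X in r `^ X](_ : _ = 1 - theta - 1); last by ring.
  have dcp : is_derive r 1 (fun t => c * t `^ (1 - theta))
      (c * ((1 - theta) * r `^ (1 - theta - 1))) := is_deriveZ c dp.
  exact: (@derive_val _ _ _ _ _ _ _ dcp).
have dist_le : (dist_set 0%R (limiting_subdiff F (x k.+1)) <= (enorm v)%:E)%E.
  by apply: ereal_inf_lbound; exists v => //; rewrite sub0r enormN.
set D := c * _ => KLk.
have D0 : 0 <= D by rewrite /D !mulr_ge0 ?powR_ge0 ?ltW.
have : 1 <= D * enorm v.
  rewrite -lee_fin EFinM; apply: le_trans KLk _.
  by apply: lee_wpmul2l; rewrite ?lee_fin.
rewrite /D powRN => h.
have rt : 0 < r `^ theta by rewrite powR_gt0.
move: h; rewrite mulrA mulrAC ler_pdivlMr// mul1r //.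
Qed.

(** The values are monotone, so lower semicontinuity at an accumulation point
bounds all of them from below. *)
Lemma value_ge_limit : lower_semicontinuous F ->
  (forall (d : R) N, 0 < d -> exists k, [/\ (N <= k)%N, S k & enorm (x k - xs) < d]) ->
  forall k, Fs <= Fr k.
Proof.
move=> lF acc k; rewrite leNgt; apply/negP => lt.
have Fxs : F xs = Fs%:E by rewrite /Fs fineK//; exact/edom_objective.
have [|V Vxs hV] := lF xs (Fr k); first by rewrite Fxs lte_fin.
have [d d0 dV] := eball_nbhs Vxs.
have [i [ki _ xi]] := acc d k d0.
have := hV (x i) (dV _ (ltW xi)).
rewrite /F (objective_edom f phi_neqNy (iterate_edom i)) lte_fin.
have := value_noninc ki; rewrite /Fr /F.
by rewrite (objective_edom f phi_neqNy (iterate_edom i))/=; lra.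
Qed.

Lemma small_decrease (d : R) : 0 < d -> (forall k, Fs <= Fr k) ->
  exists N, forall k, (N <= k)%N -> Fr k - Fr k.+1 < d.
Proof.
move=> d0 Fge; pose A := range Fr.
have iA : has_inf A.
  by split; [exists (Fr 0), 0%N|exists Fs => _ [k _ <-]].
have [_ [N _ <-] hN] := inf_adherent d0 iA.
exists N => k Nk; have := value_noninc Nk.
have : inf A <= Fr k.+1 by apply: ge_inf => //; [case: iA|exists k.+1].
lra.
Qed.

(** At a success [k] with [x k] close to [xs] and a short step, comparing the
minimizer of the model with [xs] bounds the next value from above. *)
Lemma value_to_limit : lower_semicontinuous F ->
  (forall (d : R) N, 0 < d -> exists k, [/\ (N <= k)%N, S k & enorm (x k - xs) < d]) ->
  forall d : R, 0 < d -> exists k, Fr k - Fs < d.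
Proof.
move=> lF acc d d0; have Fge := value_ge_limit lF acc.
have MB0 : 0 <= MB := ltW MB_gt0.
have muhat0 : 0 < muhat.
  have /andP[h1 h2] := run_mu0 run.
  exact: lt_le_trans (lt_le_trans mumin_gt0 h1) (le_trans h2 muhat_max).
pose W := L + MB + muhat.
have W0 : 0 < W by rewrite ltr_wpDl// addr_ge0.
(* A radius for which both squared distances in the comparison contribute at
most [d / 3]. *)
pose tau := Num.min (e / 2) (Num.sqrt (d / 3 / W)).
have dW : 0 < d / 3 / W by rewrite !divr_gt0.
have tau0 : 0 < tau by rewrite lt_min divr_gt0// sqrtr_gt0.
have tauW : W * tau ^+ 2 <= d / 3.
  rewrite mulrC -ler_pdivlMr// -[leRHS]sqr_sqrtr ?(ltW dW)//.
  by rewrite ler_pXn2r ?nnegrE ?(ltW tau0) ?sqrtr_ge0// ge_min lexx orbT.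
have [N hN] := small_decrease (mulr_gt0 decrease_const_gt0 (exprn_gt0 2 tau0)) Fge.
have [k [Nk Sk xk]] := acc tau N tau0.
have taue : tau <= e / 2 by rewrite ge_min lexx.
have dk : enorm (x k.+1 - x k) <= tau.
  rewrite -(ler_pXn2r (n := 2))// ?nnegrE ?enorm_ge0 ?(ltW tau0)//.
  rewrite -(ler_pM2l decrease_const_gt0).
  exact: le_trans (iterate_decrease k) (ltW (hN k Nk)).
have xke : enorm (x k - xs) <= e / 2 by exact: ltW (lt_le_trans xk taue).
exists k.+1.
have := minimizer_value_le phi_neqNy (iterate_edom k) (success_minimizer Sk)
  (B_bounded k) f_diff f_lip L_ge0 (le_trans (ltW mumin_gt0) (mu_ge k)).
have eb : eball xs e (x k) by apply: le_trans xke _; rewrite ler_pdivrMr// ler_pMr// ler1n.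
have eb1 : eball xs e (x k.+1).
  rewrite /eball/=; apply: le_trans (enorm_triangle (x k) _ _) _.
  by rewrite [leRHS](splitr e) lerD// (le_trans dk).
have eb2 : eball xs e xs by rewrite /eball/= subrr enorm0 ltW.
move=> /(_ _ eb eb1 eb2 xs_edom); rewrite -/(Fr k.+1) -/Fs => h.
have b1 : (L + MB) * enorm (x k.+1 - x k) ^+ 2 <= W * tau ^+ 2.
  apply: ler_pM; rewrite ?sqr_ge0 ?addr_ge0// ?lerDl ?(ltW muhat0)//.
  by rewrite ler_pXn2r ?nnegrE ?enorm_ge0 ?(ltW tau0).
have b2 : (L + MB + mu k) * enorm (xs - x k) ^+ 2 <= W * tau ^+ 2.
  apply: ler_pM; rewrite ?sqr_ge0 ?addr_ge0//.
  - exact: le_trans (ltW mumin_gt0) (mu_ge k).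
  - by rewrite lerD2l mu_le_near.
  - by rewrite enorm_distC ler_pXn2r ?nnegrE ?enorm_ge0 ?(ltW tau0)// ltW.
lra.
Qed.

End NearStationaryPoint.
End AlgorithmRun.

(** * Successful iterations and the convergence theorem *)

Section Enumeration.
Context (S : set nat) (k0 : nat) (s : nat -> nat).
Hypothesis es : enumerates_from S k0 s.

Lemma enumerates_homo : {homo s : i j / (i < j)%N}.
Proof. by case: es. Qed.

Lemma enumerates_mono : {mono s : i j / (i <= j)%N}.
Proof. exact: leq_mono enumerates_homo. Qed.

Lemma enumerates_mem j : S (s j) /\ (k0 <= s j)%N.
Proof.
case: es => _ _ rs; suff : (S `&` [set k | (k0 <= k)%N]) (s j) by [].
by rewrite -rs; exists j.
Qed.

Lemma enumerates_onto i : S i -> (k0 <= i)%N -> exists j, s j = i.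
Proof.
case: es => _ _ rs Si ki; have : (S `&` [set k | (k0 <= k)%N]) i by [].
by rewrite -rs => -[j _ <-]; exists j.
Qed.

Lemma enumerates_gap j i : (s j < i < s j.+1)%N -> ~ S i.
Proof.
move=> /andP[ji ij] Si; have [_ kj] := enumerates_mem j.
have [m mi] := enumerates_onto Si (leq_trans kj (ltnW ji)).
move: ji ij; rewrite -mi !(leqW_mono enumerates_mono) ltnS.
by move=> jm; rewrite leqNgt jm.
Qed.

Lemma enumerates_ge j : (j <= s j)%N.
Proof.
elim: j => // j IH; apply: leq_ltn_trans IH _; exact: enumerates_homo.
Qed.

End Enumeration.

Theorem theorem4p4 (R : realType) (n : nat)
  (f : 'rV[R]_n -> R) (phi : 'rV[R]_n -> \bar R)
  (c1 sigma2 mumin mumax : R)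
  (x : nat -> 'rV[R]_n) (B : nat -> 'M[R]_n) (mu : nat -> R)
  (xhat : nat -> option 'rV[R]_n)
  (MB : R) (xstar : 'rV[R]_n) (c theta : R) (k0 : nat) (s : nat -> nat) :
  let F := objective f phi in
  let S := successful f phi c1 x B xhat in
  (forall y, phi y != -oo%E) ->
  proper_fun F -> lower_semicontinuous F ->
  (exists O : set 'rV[R]_n, [/\ open O, edom phi `<=` O & C1_on O f]) ->
  proper_fun phi -> lower_semicontinuous phi -> prox_bounded phi ->
  (-oo < ereal_inf (range F))%E ->
  0 < c1 < 1 -> 1 < sigma2 -> 0 < mumin -> mumin <= mumax ->
  algorithm_run f phi c1 sigma2 mumin mumax x B mu xhat ->
  0 < MB -> (forall k, opnorm (B k) <= MB) ->
  (forall y, edom phi y -> exists L e : R, [/\ 0 < L, 0 < e &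
     forall z w, eball y e z -> eball y e w ->
       enorm (grad f z - grad f w) <= L * enorm (z - w)]) ->
  stationary F xstar ->
  accumulation_point_along S x xstar ->
  0 < c -> 0 < theta < 1 ->
  KL_property_with (fun t => c * t `^ (1 - theta)) F xstar ->
  S k0 -> enumerates_from S k0 s ->
  [/\ exists N : nat, forall j, (s j.+1 - s j <= N)%N,
      theta < 2^-1 ->
        Q_superlinear (2 * theta)^-1 (fun k => fine (F (x (s k)))) (fine (F xstar))
        /\ R_superlinear (2 * theta)^-1 (fun k => x (s k)) xstar,
      theta = 2^-1 ->
        Q_linear (fun k => fine (F (x (s k)))) (fine (F xstar))
        /\ R_linear (fun k => x (s k)) xstar
    & 2^-1 < theta ->
        exists C1 C2 : R, [/\ 0 < C1, 0 < C2 &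
          \forall k \near \oo,
            (F (x (s k)) - F xstar
               <= (C1 * k%:R `^ (- (2 * theta - 1)^-1))%:E)%E /\
            enorm (x (s k) - xstar)
              <= C2 * k%:R `^ (- ((1 - theta) / (2 * theta - 1)))]].
Proof.
move=> F S phiN _ lF [Om [Oo domO C1f]] _ lphi pb _ c101 s1 mm0 mM run MB0 BM lip.
move=> stat acc c0 t01 [_ [eta [U [eta0 Uxs _ KL]]]] _ es.
have dxs : edom phi xstar by apply/(edom_objective f phiN); case: stat.
have [L [e1 [L0 e10 lip1]]] := lip xstar dxs.
have [e2 e20 e2O] := eball_nbhs (open_nbhs_nbhs (conj Oo (domO _ dxs))).
pose e := Num.min e1 e2.
have e0 : 0 < e by rewrite lt_min e10.
have ee1 : e <= e1 by rewrite ge_min lexx.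
have ee2 : e <= e2 by rewrite ge_min lexx orbT.
have fd y : eball xstar e y -> differentiable f y.
  by move=> ye; have [] := C1f y (e2O _ (le_trans ye ee2)).
have fl y w : eball xstar e y -> eball xstar e w ->
    enorm (grad f y - grad f w) <= L * enorm (y - w).
  by move=> ye we; apply: lip1; [exact: le_trans ye ee1|exact: le_trans we ee1].
have [mub hmub] := large_mu_success phiN c101 s1 mm0 run BM e0 (ltW L0) fd fl
  lphi pb.
pose muhat := Num.max mumax (sigma2 * mub).
have mh1 : mumax <= muhat by rewrite le_max lexx.
have mh2 : sigma2 * mub <= muhat by rewrite le_max lexx orbT.
have muhat0 : 0 < muhat := lt_le_trans (lt_le_trans mm0 mM) mh1.
have [rU rU0 rUU] := eball_nbhs Uxs.
pose rho := Num.min (e / 2) rU.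
have rho0 : 0 < rho by rewrite lt_min divr_gt0.
have rhoe : rho <= e / 2 by rewrite ge_min lexx.
have rhoU : rho <= rU by rewrite ge_min lexx orbT.
have KL' y : enorm (y - xstar) < rho -> (F xstar < F y < F xstar + eta%:E)%E ->
    (1 <= (derive1 (fun t => c * t `^ (1 - theta)) (fine (F y - F xstar)))%:E
          * dist_set 0%R (limiting_subdiff F y))%E.
  by move=> ye; apply: KL; apply: rUU; exact: le_trans (ltW ye) rhoU.
have accS (d : R) N : 0 < d ->
    exists k, [/\ (N <= k)%N, S k & enorm (x k - xstar) < d].
  move=> d0; case: acc => m [mi mS mx].
  have d2 : 0 < d / 2 by rewrite divr_gt0.
  have [M _ hM] := mx _ (nbhs_eball xstar d2).
  have mge i : (i <= m i)%N.
    by elim: i => // i IH; apply: leq_ltn_trans IH _; exact: mi.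
  exists (m (maxn N M)); split => //; first exact: leq_trans (leq_maxl _ _) (mge _).
  have /= h := hM (maxn N M) (leq_maxr _ _).
  by apply: le_lt_trans h _; rewrite ltr_pdivrMr// ltr_pMr// ltr1n.
have xS j : x (s j.+1) = x (s j).+1.
  apply: (iterate_after_failures run); first exact: (enumerates_homo es).
  by move=> i; exact: (enumerates_gap es).
pose u j := fine (F (x (s j))); pose Fs := fine (F xstar).
have Fge := value_ge_limit phiN c101 s1 mm0 run dxs lF accS.
have K0 : 0 < c * (1 - theta) * (L + MB + muhat).
  by case/andP: t01 => _ t1; rewrite !mulr_gt0 ?subr_gt0 ?addr_gt0.
have [] := @descent_KL_rates R n (fun j => x (s j)) u Fs xstar
  (c1 * (mumin / 2)) (c * (1 - theta) * (L + MB + muhat)) theta rho eta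
  (decrease_const_gt0 c101 mm0) K0 t01 rho0 eta0 (fun j => Fge (s j)).
- by move=> j; rewrite /u xS; exact: (iterate_decrease phiN c101 s1 mm0 run).
- move=> j; rewrite /u xS => yj yj1 uj.
  apply: (success_KL phiN s1 mm0 run BM e0 dxs fd fl hmub mh1 mh2 c0 t01 KL'
    rhoe) => //; first by have [] := enumerates_mem es j.
- move=> d N d0; have [k [Nk Sk xk]] := accS d (s N) d0.
  have [_ kN] := enumerates_mem es N.
  have [j jk] := enumerates_onto es Sk (leq_trans kN Nk).
  by exists j; rewrite ?jk// -(enumerates_mono es) jk.
- move=> d d0; have [k uk] := value_to_limit phiN c101 s1 mm0 run MB0 BM e0
    (ltW L0) dxs fd fl hmub mh1 mh2 lF accS d0.
  exists k; apply: le_lt_trans uk; rewrite lerD2r.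
  exact: (value_noninc phiN c101 s1 mm0 run (enumerates_ge es k)).
move=> [J trap] ra rb rc; split => //.
- have [N hN] := failures_bounded s1 mm0 run hmub.
  exists (maxn N (s J)) => j; case: (leqP J j) => Jj.
    apply: leq_trans (leq_maxl _ _); apply: hN.
    + exact: (enumerates_homo es).
    + by move=> i; exact: (enumerates_gap es).
    + by rewrite -xS; apply: le_trans (ltW (trap _ _)) rhoe; exact: leqW.
  apply: leq_trans (leq_maxr _ _); apply: leq_trans (leq_subr _ _) _.
  by rewrite (enumerates_mono es).
- move=> t2; have [C1 [C2 [C10 C20 h]]] := rc t2; exists C1, C2; split => //.
  apply: filterS h => k [h1 h2]; split => //.
  rewrite -[F (x (s k))]fineK; last first.
    by apply/edom_objective => //; exact: (iterate_edom phiN run).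
  by rewrite -[F xstar]fineK ?lee_fin//; exact/edom_objective.
Qed.
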